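(* Let $G=C_{n_1}\oplus C_{n_2}\oplus C_{n_3}\oplus C_{n_4}$ be a finite abelian group of rank $4$ with $1<n_1\mid n_2\mid n_3\mid n_4$. Then $$\beta_{\mathrm{sep}}(G)=\frac{n_2}{p}+n_3+n_4,$$ where $p$ is the minimal prime divisor of $n_1$ and $\beta_{\mathrm{sep}}(G)$ denotes the separating Noether number of $G$.
   Context: $C_n$ denotes the cyclic group of order $n$. For a finite group $G$ and a finite dimensional $\mathbb{C}G$-module $V$, $G$ acts on the coordinate ring $\mathbb{C}[V]$ by $(g\cdot f)(v)=f(g^{-1}\cdot v)$, and $\mathbb{C}[V]^G=\{f\in\mathbb{C}[V]: g\cdot f=f \text{ for all } g\in G\}$. A subset $S\subseteq\mathbb{C}[V]^G$ is a separating set if for any two $v_1,v_2\in V$ for which there is $h\in\mathbb{C}[V]^G$ with $h(v_1)\neq h(v_2)$, there exists $f\in S$ with $f(v_1)\ne f(v_2)$ (since $G$ is finite, this is equivalent to: $Gv_1\neq Gv_2$ implies $f(v_1)\neq f(v_2)$ for some $f\in S$). $\beta_{\mathrm{sep}}(G,V)$ is the minimal positive integer $d$ such that $\mathbb{C}[V]^G$ contains a separating set consisting of homogeneous polynomials of degree at most $d$. The separating Noether number is $\beta_{\mathrm{sep}}(G)=\sup\{\beta_{\mathrm{sep}}(G,V): V \text{ a finite dimensional } \mathbb{C}G\text{-module}\}$. *)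

(* Defs.v *)
From mathcomp Require Import all_boot all_order all_algebra all_fingroup.
From mathcomp Require Import all_solvable all_character.
From mathcomp Require Import complex mpoly.
From mathcomp Require Import classical_sets reals constructive_ereal.
From mathcomp Require ereal.

Set Implicit Arguments.
Unset Strict Implicit.
Unset Printing Implicit Defensive.

Import GRing.Theory.
Local Open Scope ring_scope.
Local Open Scope classical_set_scope.
Local Open Scope complex_scope.

(* A finite dimensional C G-module, with C = R[i] for R the real numbers, is
   given in coordinates: V = 'cV[R[i]]_n is the space of column vectors, on
   which g in G acts (on the left) by v |-> rG g *m v.  The coordinate ring
   C[V] is {mpoly R[i][n]}, the variable 'X_i being the i-th coordinate
   function. *)

Section SeparatingSets.

Variables (R : realType) (gT : finGroupType) (G : {group gT}) (n : nat).
Variable rG : mx_representation R[i] G n.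

Definition mact (g : gT) (v : 'cV[R[i]]_n) : 'cV[R[i]]_n := rG g *m v.

Definition peval (f : {mpoly R[i][n]}) (v : 'cV[R[i]]_n) : R[i] :=
  f.@[fun i => v i 0].

(* (g . f)(v) = f (g^-1 . v): the i-th coordinate function is replaced by the
   linear form v |-> (g^-1 . v)_i; see peval_pact. *)
Definition pact (g : gT) (f : {mpoly R[i][n]}) : {mpoly R[i][n]} :=
  f \mPo [tuple \sum_(j < n) rG g^-1%g i j *: 'X_j | i < n].

Lemma peval_pact (g : gT) (f : {mpoly R[i][n]}) (v : 'cV[R[i]]_n) :
  peval (pact g f) v = peval f (mact g^-1%g v).
Proof.
rewrite /peval /pact comp_mpoly_meval; apply: meval_eq => i.
rewrite tnth_mktuple raddf_sum /= mxE; apply: eq_bigr => j _.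
by rewrite mevalZ mevalXU.
Qed.

Definition invariant (f : {mpoly R[i][n]}) : Prop :=
  forall g, g \in G -> pact g f = f.

Definition separating_set (S : set {mpoly R[i][n]}) : Prop :=
  S `<=` invariant /\
  forall v1 v2 : 'cV[R[i]]_n,
    (exists2 h, invariant h & peval h v1 <> peval h v2) ->
    exists2 f, S f & peval f v1 <> peval f v2.

Definition separated_in_degree (d : nat) : Prop :=
  exists2 S : set {mpoly R[i][n]}, separating_set S &
    forall f, S f -> exists2 k, (k <= d)%N & f \is k.-homog.

(* The least positive d with separated_in_degree d, as an extended real
   (it would be +oo if there were none). *)
Definition beta_sep_module : \bar R :=
  ereal.ereal_inf
    [set d%:R%:E | d in [set d | (0 < d)%N /\ separated_in_degree d]].

End SeparatingSets.

Definition beta_sep (R : realType) (gT : finGroupType) (G : {group gT}) :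
    \bar R :=
  ereal.ereal_sup [set b | exists n (rG : mx_representation R[i] G n),
                             b = beta_sep_module rG].

(* Main.v *)
From HB Require Import structures.
Require Import Defs.
From mathcomp Require Import all_boot all_order all_algebra all_fingroup.
From mathcomp Require Import all_solvable all_field all_character.
From mathcomp Require Import complex mpoly.
From mathcomp Require Import reals constructive_ereal.
From mathcomp Require boolp ereal.
From mathcomp Require Import zify ring.

(* Over the complex numbers a module of an abelian group is a sum of
   characters, and the invariants are spanned by the monomials z^m with m in
   the lattice K of zero-sum vectors; on the vectors with a given support, two
   points are separated by no invariant of degree at most D exactly when the
   quotient of their coordinates kills every nonnegative m in K of weight at
   most D.  So one has to show that these m generate K for
   D = n2/p + n3 + n4, and to exhibit five characters for which smaller
   weights do not suffice.

   Generation is checked locally at every prime q.  Over the localization of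
   Z at q the group generated by the characters needs only as many generators
   as there are n_k divisible by q, so K is generated by vectors having one
   more nonzero coordinate than that.  With four nonzero coordinates, m or -m
   has residues modulo n3 of total weight at most 2 n3; such a vector lifts to
   K at the cost of n4 - n3, because the multiples of n3 only see a cyclic
   group of order n4/n3.  With five coordinates q divides n1, and writing
   n2 = c q^e with c prime to q, some multiple t m with t prime to q has
   residues modulo q^e of total weight at most 2 q^e + q^(e-1): the sums for
   t m and - t m are opposite modulo q^e and add up to at most 5 q^e.
   Multiplying by c and lifting from n2 to K costs n3 + n4 - 2 n2, whence the
   bound. *)

Set Implicit Arguments.
Unset Strict Implicit.
Unset Printing Implicit Defensive.

Import Order.TTheory GRing.Theory Num.Theory.
Local Open Scope ring_scope.

(** * Subgroups of the lattice of zero-sum vectors *)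

Section Subgroup.
Variables (V : zmodType) (P : V -> Prop).

Definition subgroup : Prop := P 0 /\ forall x y, P x -> P y -> P (x - y).

Hypothesis subP : subgroup.

Lemma subgroupN x : P x -> P (- x).
Proof. by case: subP => P0 PB /(PB 0 x P0); rewrite sub0r. Qed.

Lemma subgroupD x y : P x -> P y -> P (x + y).
Proof. by move=> Px /subgroupN Py; rewrite -[y]opprK; apply: subP.2. Qed.

Lemma subgroupMz x (z : int) : P x -> P (x *~ z).
Proof.
move=> Px; have Pn k : P (x *+ k).
  by elim: k => [|k IH]; [apply: subP.1 | rewrite mulrS; apply: subgroupD].
by case: z => k; [exact: Pn | apply/subgroupN/Pn].
Qed.

(** The integers N with [P (x *~ N)] form an ideal of Z that is contained in no prime ideal, so it
    contains 1. *)
Lemma subgroup_local x :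
  (forall q, prime q -> exists2 N : int, ~~ (q%:Z %| N)%Z & P (x *~ N)) -> P x.
Proof.
move=> Ploc.
have Pgcd (c d : int) : P (x *~ c) -> P (x *~ d) -> P (x *~ gcdz c d).
  move=> Pc Pd; have [u [v <-]] := Bezoutz c d.
  rewrite mulrzDr; apply: subgroupD; rewrite mulrC -mulrzA_C.
    by rewrite mulrzAC; apply: subgroupMz.
  by rewrite mulrzAC; apply: subgroupMz.
have main k : forall d : nat, (0 < d <= k)%N -> P (x *~ d) -> P x.
  elim: k => [|k IH] d; first by lia.
  case/andP=> d_gt0 le_d Pd.
  have [d1|d_neq1] := eqVneq d 1%N; first by move: Pd; rewrite d1.
  have q_pr : prime (pdiv d) by apply: pdiv_prime; lia.
  have [N qN PN] := Ploc _ q_pr.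
  have dq := pdiv_dvd d.
  (* Since q divides d but not N, the gcd is a proper divisor of d, and the descent continues with
     it. *)
  apply: (IH (gcdn d `|N|)); last exact: (Pgcd d N).
  have gd : (gcdn d `|N| %| d)%N by rewrite dvdn_gcdl.
  have := dvdn_leq d_gt0 gd.
  rewrite leq_eqVlt => /orP[/eqP e|]; last by rewrite gcdn_gt0; lia.
  case/negP: qN; rewrite dvdzE /=; apply: dvdn_trans dq _.
  by rewrite -e dvdn_gcdr.
(* Any prime provides a nonzero multiple from which to start the descent. *)
have [N N0 PN] := Ploc 2%N isT.
have N_neq0 : N != 0 by apply: contraNneq N0 => ->; rewrite dvdz0.
apply: (main `|N|%N `|N|%N); first by lia.
by rewrite -(gcdz0 N); apply: (Pgcd N 0) => //; rewrite mulr0z; apply: subP.1.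
Qed.

End Subgroup.

(** * Zero-sum vectors and elimination at one prime *)

Section Lattice.
Variables (I T : finType) (a : T -> I -> int).
Implicit Types (n : T -> nat) (m w x y : {ffun I -> int}) (S J : {set I}).

(** [a k i] will be the exponent of the i-th character on the generator of the k-th cyclic factor;
    [zero_sum] then says that the monomial with exponents [m] is invariant. *)
Definition pairing k m : int := \sum_i a k i * m i.

Fact pairing_is_additive k : additive (pairing k).
Proof.
move=> m w; rewrite /pairing -sumrB; apply: eq_bigr => i _.
by rewrite !ffunE mulrBr.
Qed.

HB.instance Definition _ k :=
  GRing.isZmodMorphism.Build {ffun I -> int} int (pairing k)
    (pairing_is_additive k).

Definition zero_sum n m : Prop := forall k, ((n k)%:Z %| pairing k m)%Z.
Definition supported S m : Prop := forall i, i \notin S -> m i = 0.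
Definition weight m : int := \sum_i m i.

Lemma zero_sum_subgroup n : subgroup (zero_sum n).
Proof.
split=> [k|x y Kx Ky k]; first by rewrite raddf0 dvdz0.
by rewrite raddfB; apply: rpredB; [apply: Kx | apply: Ky].
Qed.

Lemma supported_subgroup S : subgroup (supported S).
Proof.
split=> [i _|x y Sx Sy i iS]; first by rewrite ffunE.
by rewrite !ffunE Sx // Sy // subr0.
Qed.

Lemma supportedW S S' m : S \subset S' -> supported S m -> supported S' m.
Proof.
by move=> sSS' Sm i iS; apply: Sm; apply: contraNN iS; apply: subsetP.
Qed.

Lemma mulrzffunE m z i : (m *~ z) i = m i * z.
Proof. by rewrite ffunMzE mulrzz. Qed.

(** Multiples of N in the lattice are the lattice of smaller moduli, which become 1 wherever [n k]
    divides N. *)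
Lemma zero_sum_scale n N m : (0 < N)%N ->
  zero_sum n (m *~ N%:Z) <-> zero_sum (fun k => lcmn (n k) N %/ N)%N m.
Proof.
move=> N_gt0.
suff E k : ((n k)%:Z %| pairing k (m *~ N%:Z))%Z =
    ((lcmn (n k) N %/ N)%N%:Z %| pairing k m)%Z.
  by split=> H k; [rewrite -E | rewrite E].
rewrite raddfMz /= mulrzz !dvdzE abszM /=.
rewrite -[in RHS](dvdn_pmul2r N_gt0) divnK ?dvdn_lcmr // dvdn_lcm.
by rewrite (dvdn_mull _ (dvdnn N)) andbT.
Qed.


Lemma prime_dvdzM q (b c : int) : prime q ->
  (q%:Z %| b * c)%Z = (q%:Z %| b)%Z || (q%:Z %| c)%Z.
Proof. by move=> q_pr; rewrite !dvdzE abszM Euclid_dvdM. Qed.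

(** Choice of a pivot: d is the largest power of q dividing [b i0], where [b i0] has minimal q-adic
    valuation among the nonzero values on A. *)
Lemma minimal_valuation q (A : pred I) (b : I -> int) : prime q ->
  (forall i, A i -> b i = 0) \/
  exists i0 (d : int), [/\ A i0, b i0 != 0, ~~ (q%:Z %| (b i0 %/ d)%Z)%Z &
    forall i, A i -> (d %| b i)%Z].
Proof.
move=> q_pr; have q_gt1 := prime_gt1 q_pr.
case: (pickP [pred i | A i & b i != 0]) => [i1 Ai1|none]; last first.
  by left=> i Ai; have /= := none i; rewrite Ai /= => /negbFE/eqP.
right; case: (arg_minnP (fun i => logn q `|b i|) Ai1) => i0 /andP[Ai0 bi0] i0_min.
exists i0, (q ^ logn q `|b i0|)%N%:Z; split=> // [|i Ai].
  apply/negP => qdvd.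
  have e : b i0 = (b i0 %/ (q ^ logn q `|b i0|)%N)%Z * (q ^ logn q `|b i0|)%N.
    by rewrite divzK // dvdzE /= pfactor_dvdnn.
  have : ((q ^ (logn q `|b i0|).+1)%N%:Z %| b i0)%Z.
    by rewrite [X in (_ %| X)%Z]e expnS PoszM; apply: dvdz_mul.
  by rewrite dvdzE /= pfactor_dvdn ?absz_gt0 // ltnn.
rewrite dvdzE /=; have [->|bi] := eqVneq (b i) 0; first by rewrite dvdn0.
by rewrite pfactor_dvdn ?absz_gt0 //; apply: i0_min; rewrite /= Ai.
Qed.

(* Gaussian elimination over the localization of Z at q: a pivot of minimal
   q-adic valuation is used for each of the conditions modulo n k, except
   that no pivot is needed when n k is invertible. *)
Lemma local_generators q S n : prime q ->
  exists J, [/\ J \subset S, (#|J| <= #|[set k | q %| n k]|)%N &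
    forall i, i \in S -> i \notin J -> exists y,
      [/\ zero_sum n y, supported (i |: J) y & ~~ (q%:Z %| y i)%Z]].
Proof.
move=> q_pr.
suff [J [JS cardJ HJ]] : exists J, [/\ J \subset S,
    (#|J| <= count (fun k => q %| n k) (enum T))%N &
    forall i, exists y, i \in S -> i \notin J ->
      [/\ forall k, k \in enum T -> ((n k)%:Z %| pairing k y)%Z,
          supported (i |: J) y & ~~ (q%:Z %| y i)%Z]].
  exists J; split=> //.
    by apply: leq_trans cardJ _; rewrite enumT cardsE cardE /enum_mem size_filter.
  move=> i iS iJ; have [y Hy] := HJ i; have [Ky Sy yi] := Hy iS iJ.
  by exists y; split=> // k; apply: Ky; rewrite mem_enum.
elim: (enum T) => [|k s [J [JS cardJ /fin_all_exists[y Hy]]]].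
  exists set0; split; rewrite ?sub0set ?cards0 // => i.
  exists [ffun j => (j == i)%:Z] => _ _; split=> [//|j|].
    by rewrite !inE ffunE orbF => /negPf->.
  by rewrite ffunE eqxx dvdzE /= dvdn1; case: q q_pr => [|[|]].
have [qn|qn] /= := boolP (q %| n k)%N; last first.
  exists J; split=> [//||i]; first by rewrite (negbTE qn).
  (* Multiplication by [n k], which is prime to q, enforces the new condition and keeps coordinate i
     prime to q. *)
  exists (y i *~ n k) => iS iJ.
  have [Ky Sy yi] := Hy i iS iJ; split=> [l||].
  - rewrite inE => /orP[/eqP->|ls]; rewrite raddfMz /= mulrzz.
      exact: dvdz_mull.
    exact/dvdz_mulr/Ky.
  - exact: (subgroupMz (supported_subgroup _)).
  - by rewrite mulrzffunE prime_dvdzM // negb_or yi.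
have [b0|[i0 [d [/andP[i0S i0J] bi0 qd dvdb]]]] :=
  minimal_valuation [pred i | (i \in S) && (i \notin J)]
    (fun i => pairing k (y i)) q_pr.
  exists J; split; [by [] | exact: leq_trans cardJ (leq_addl _ _) |].
  move=> i; exists (y i) => iS iJ; have [Ky Sy yi] := Hy i iS iJ.
  split=> // l; rewrite inE => /orP[/eqP->|]; last exact: Ky.
  by rewrite b0 ?dvdz0 //= iS.
have d_neq0 : d != 0.
  apply: contraNneq bi0 => d0; have := dvdb i0; rewrite d0 dvd0z.
  by apply; rewrite /= i0S.
exists (i0 |: J); split.
- by rewrite subUset sub1set i0S.
- by rewrite cardsU1 i0J qn leq_add2l.
move=> i; set b := fun i => pairing k (y i) in bi0 qd dvdb.
(* The pairing with k cancels exactly, and coordinate i is only multiplied by [b i0 %/ d], which is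
   prime to q. *)
exists (y i *~ (b i0 %/ d)%Z - y i0 *~ (b i %/ d)%Z) => iS.
rewrite !inE negb_or => /andP[i_neq iJ].
have [Ky Sy yi] := Hy i iS iJ; have [Ky0 Sy0 yi0] := Hy i0 i0S i0J.
split=> [l||].
- rewrite inE raddfB /= !raddfMz /= !mulrzz ?mulNr => /orP[/eqP->|ls].
    rewrite -/(b i) -/(b i0); suff -> : b i * (b i0 %/ d)%Z = b i0 * (b i %/ d)%Z.
      by rewrite subrr dvdz0.
    rewrite -{1}(@divzK d (b i)) ?dvdb /= ?iS //.
    rewrite -{2}(@divzK d (b i0)) ?dvdb /= ?i0S //; ring.
  by apply: rpredB; apply: dvdz_mulr; [apply: Ky | apply: Ky0].
- apply: (supported_subgroup _).2;
    apply: (subgroupMz (supported_subgroup _));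
    [apply: supportedW Sy | apply: supportedW Sy0].
    by rewrite setUCA subsetUr.
  by rewrite subsetUr.
- rewrite !ffunE !mulrzffunE (Sy0 i) ?inE ?negb_or ?i_neq //.
  by rewrite mul0r subr0 prime_dvdzM // negb_or yi.
Qed.


(** The vectors y clear the coordinates outside J one at a time, at the price of multiplying m by
    integers prime to q. *)
Lemma local_descent (P : {ffun I -> int} -> Prop) q J n :
    subgroup P -> prime q ->
    (forall m, zero_sum n m -> supported J m -> P m) ->
    (forall i, i \notin J -> exists y,
      [/\ zero_sum n y, P y, supported (i |: J) y & ~~ (q%:Z %| y i)%Z]) ->
  forall m, zero_sum n m -> exists2 N : int, ~~ (q%:Z %| N)%Z & P (m *~ N).
Proof.
move=> subP q_pr PJ Py m.
have [k] := ubnP #|[set i | (i \notin J) && (m i != 0)]|.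
elim: k m => // k IH m le_k Km.
case: (pickP [pred i | (i \notin J) && (m i != 0)]) => [i|none]; last first.
  exists 1; first by rewrite dvdzE dvdn1; case: (q) q_pr => [|[|]].
  rewrite mulr1z; apply: PJ => // i iJ.
  by have := none i; rewrite /= iJ => /negbFE/eqP.
case/andP=> iJ mi; have [y [Ky Pyi Sy yi]] := Py i iJ.
(* Coordinate i vanishes in m', and no zero coordinate outside J becomes nonzero, because y lives on
   [i |: J]. *)
pose m' := m *~ y i - y *~ m i.
have m'E j : m' j = m j * y i - y j * m i by rewrite !ffunE !mulrzffunE.
have [||N qN PN] := IH m'.
- rewrite -ltnS (leq_trans _ le_k) // ltnS proper_card //; apply/properP; split.
    apply/subsetP => j; rewrite !inE m'E => /andP[jJ]; rewrite jJ.
    have [->|j_neq] := eqVneq j i; first by rewrite mulrC subrr eqxx.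
    have -> : y j = 0 by apply: Sy; rewrite !inE negb_or j_neq.
    by rewrite mul0r subr0 mulf_eq0 negb_or => /andP[].
  by exists i; rewrite !inE iJ //= m'E mulrC subrr eqxx.
- by apply: (zero_sum_subgroup _).2; apply: (subgroupMz (zero_sum_subgroup _)).
exists (y i * N); first by rewrite prime_dvdzM // negb_or yi.
have -> : m *~ (y i * N) = m' *~ N + y *~ (m i * N).
  by apply/ffunP => j; rewrite !ffunE !mulrzffunE m'E; ring.
by apply: (subgroupD subP PN); apply: subgroupMz.
Qed.

(** Elimination leaves a set J of at most c indices, and the generators it produces live on J and
    one further index. *)
Lemma local_small_support (P : {ffun I -> int} -> Prop) q n c :
    subgroup P -> prime q -> (#|[set k | q %| n k]| <= c)%N ->
    (forall S m, (#|S| <= c.+1)%N -> zero_sum n m -> supported S m -> P m) ->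
  forall m, zero_sum n m -> exists2 N : int, ~~ (q%:Z %| N)%Z & P (m *~ N).
Proof.
move=> subP q_pr le_c PS.
have [J [_ cardJ HJ]] := local_generators [set: I] n q_pr.
have cJ : (#|J| <= c)%N by apply: leq_trans le_c.
apply: (@local_descent P q J n) => // [m|i iJ]; first exact/PS/leqW.
have [y [Ky Sy yi]] := HJ i (in_setT i) iJ.
by exists y; split=> //; apply: (PS (i |: J)); rewrite // cardsU1 iJ.
Qed.

Lemma solve_mod_prime q (b c : int) : prime q -> ~~ (q%:Z %| b)%Z ->
  exists t, (q%:Z %| c - b * t)%Z.
Proof.
move=> q_pr qb; have cop : coprimez q b.
  by rewrite coprimezE prime_coprime // -dvdzE.
have [u [v e]] := Bezoutz q b; rewrite (eqP cop) in e.
exists (v * c); apply/dvdzP; exists (u * c).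
by rewrite -[X in X - _]mul1r -e; ring.
Qed.

(** For each i in S outside J, a multiple of the vector y attached to i makes coordinate i divisible
    by q; it disturbs no other coordinate outside J. *)
Lemma reduce_mod_prime q n S w : prime q -> supported S w ->
  exists J w', [/\ (#|J| <= #|[set k | q %| n k]|)%N, supported S w',
    zero_sum n (w - w') & forall i, i \notin J -> (q%:Z %| w' i)%Z].
Proof.
move=> q_pr Sw; have [J [JS cardJ HJ]] := local_generators S n q_pr.
have /fin_all_exists[y Hy] : forall i, exists y, i \in S :\: J ->
    [/\ zero_sum n y, supported (i |: J) y & ~~ (q%:Z %| y i)%Z].
  move=> i; have [|] := boolP (i \in S :\: J); last by exists 0.
  by rewrite inE => /andP[iJ iS]; have [y] := HJ i iS iJ; exists y.
have /fin_all_exists[t Ht] : forall i, exists t, i \in S :\: J ->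
    (q%:Z %| w i - y i i * t)%Z.
  move=> i; have [|] := boolP (i \in S :\: J); last by exists 0.
  by move/Hy=> [_ _ /(solve_mod_prime (w i) q_pr)[t]]; exists t.
have sumP (Q : {ffun I -> int} -> Prop) : subgroup Q ->
    (forall i, i \in S :\: J -> Q (y i)) ->
    Q (\sum_(i in S :\: J) y i *~ t i).
  move=> subQ Qy; apply: big_ind => [|u v|i /Qy]; first exact: subQ.1.
    exact: subgroupD.
  exact: subgroupMz.
exists J, (w - \sum_(i in S :\: J) y i *~ t i); split=> // [||i iJ].
- apply: (supported_subgroup _).2 => //.
  apply: (sumP _ (supported_subgroup _)) => i iSJ; have [_ Sy _] := Hy i iSJ.
  apply: supportedW Sy; rewrite subUset JS andbT sub1set.
  by move: iSJ; rewrite inE => /andP[].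
- rewrite opprB addrC subrK; apply: (sumP _ (zero_sum_subgroup _)) => i iSJ.
  by have [] := Hy i iSJ.
rewrite !ffunE sum_ffunE; have [iS|iS] := boolP (i \in S); last first.
  rewrite Sw // big1 ?subr0 ?dvdz0 // => j jSJ; rewrite mulrzffunE.
  have [_ Sy _] := Hy j jSJ; have -> : y j i = 0; last by rewrite mul0r.
  apply: Sy; rewrite !inE negb_or iJ andbT.
  by apply: contraNneq iS => ->; move: jSJ; rewrite inE => /andP[].
have iSJ : i \in S :\: J by rewrite inE iJ.
rewrite (bigD1 i) //= big1 ?addr0 ?mulrzffunE; first exact: Ht.
move=> j /andP[jSJ j_neq]; rewrite mulrzffunE.
have [_ Sy _] := Hy j jSJ; have -> : y j i = 0; last by rewrite mul0r.
by apply: Sy; rewrite !inE negb_or iJ andbT eq_sym.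
Qed.

Lemma weightD m w : weight (m + w) = weight m + weight w.
Proof. by rewrite /weight -big_split; apply: eq_bigr => i _; rewrite ffunE. Qed.

Lemma weightMz m z : weight (m *~ z) = weight m * z.
Proof. by rewrite /weight mulr_suml; apply: eq_bigr => i _; rewrite mulrzffunE. Qed.


(** Induction on the sum of the moduli. For a prime q dividing all moduli other than 1, w is
    congruent to d + q z, where d has entries below q and lives on J; z is then represented for the
    moduli divided by q. *)
Lemma short_representative n S w : (forall k, 0 < n k)%N ->
    (forall k l, (n k %| n l) || (n l %| n k))%N -> supported S w ->
  exists w', [/\ forall i, 0 <= w' i, supported S w', zero_sum n (w - w') &
    weight w' <= (\sum_k (n k).-1)%N%:Z].
Proof.
have [b] := ubnP (\sum_k n k)%N; elim: b n w => // b IH n w le_b n_gt0 chain Sw.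
case: (pickP [pred k | n k != 1%N]) => [k0 nk0|n1]; last first.
  exists 0; split=> [i|||].
  - by rewrite ffunE.
  - exact: (supported_subgroup S).1.
  - by move=> k; have /= /negbFE/eqP-> := n1 k; rewrite dvdzE dvd1n.
  by rewrite /weight big1 // => i _; rewrite ffunE.
(* By the chain condition the least modulus other than 1 divides all the others, so any prime
   divisor of it will do. *)
have [q q_pr q_dvd] : exists2 q, prime q & forall k, n k = 1%N \/ (q %| n k)%N.
  have [k1 nk1 k1_min] := arg_minnP n nk0; rewrite /= in nk1.
  exists (pdiv (n k1)); first by rewrite pdiv_prime // ltn_neqAle eq_sym nk1 n_gt0.
  move=> k; have [|nk] := eqVneq (n k) 1%N; [by left | right].
  apply: dvdn_trans (pdiv_dvd _) _; case/orP: (chain k1 k) => // k_dvd.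
  have := k1_min k nk; rewrite leq_eqVlt => /orP[/eqP->//|].
  by rewrite ltnNge dvdn_leq.
have q_gt1 := prime_gt1 q_pr.
have [J [w1 [cardJ Sw1 Kw1 qw1]]] := reduce_mod_prime n q_pr Sw.
pose n' k := if (q %| n k)%N then (n k %/ q)%N else n k.
pose d := [ffun i => (w1 i %% q)%Z]; pose z := [ffun i => (w1 i %/ q)%Z].
have w1E : w1 = d + z *~ q.
  by apply/ffunP => i; rewrite ffunE mulrzffunE !ffunE addrC -divz_eq.
have n'_gt0 k : (0 < n' k)%N.
  by rewrite /n'; case: ifP => // /dvdn_leq le_q; rewrite divn_gt0 ?le_q // ltnW.
have n'_dvd k : (n k %| q * n' k)%N.
  by rewrite /n'; case: ifP => [qn|_]; [rewrite mulnC divnK | exact: dvdn_mull].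
have [|||z' [z'_ge0 Sz' Kz' wz']] := IH n' z _ n'_gt0.
- rewrite -ltnS; apply: leq_trans le_b; rewrite ltnS.
  rewrite (bigD1 k0) //= [X in (_ < X)%N](bigD1 k0) //= -addSn leq_add //.
    have [e|qn] := q_dvd k0; first by rewrite /= e in nk0.
    by rewrite /n' qn ltn_Pdiv.
  by apply: leq_sum => k _; rewrite /n'; case: ifP => // _; apply: leq_div.
- move=> k l; rewrite /n'; have [ek|qk] := q_dvd k.
    by rewrite ek ifN ?dvd1n // dvdn1; case: (q) q_gt1 => [|[]].
  have [el|ql] := q_dvd l.
    by rewrite el (@ifN _ (q %| 1)%N) ?dvd1n ?orbT // dvdn1; case: (q) q_gt1 => [|[]].
  have q_gt0 : (0 < q)%N by apply: ltnW.
  by rewrite qk ql -(dvdn_pmul2r q_gt0) -[X in _ || X](dvdn_pmul2r q_gt0) !divnK.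
- by move=> i iS; rewrite ffunE Sw1 // div0z.
have Sd : supported J d.
  by move=> i /qw1; rewrite ffunE => /dvdz_mod0P.
have dE i : d i = (w1 i %% q)%Z by rewrite ffunE.
have d_ge0 i : 0 <= d i by rewrite dE modz_ge0 //; lia.
exists (d + z' *~ q); split.
- by move=> i; rewrite ffunE mulrzffunE addr_ge0 // mulr_ge0.
- move=> i iS; rewrite ffunE mulrzffunE Sz' // mul0r addr0 dE Sw1 //.
  by rewrite mod0z.
- have -> : w - (d + z' *~ q) = (w - w1) + (z - z') *~ q.
    by apply/ffunP => i; rewrite w1E !(ffunE, mulrzffunE); ring.
  apply: (subgroupD (zero_sum_subgroup n)) => // k.
  rewrite raddfMz /= mulrzz mulrC; apply: dvdz_trans (dvdz_mul (dvdzz q) (Kz' k)).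
  by rewrite -PoszM dvdzE n'_dvd.
rewrite weightD weightMz.
have wd : weight d <= (#|J| * q.-1)%N.
  rewrite /weight (bigID (mem J)) /= [X in _ + X]big1 ?addr0; last first.
    by move=> i iJ; apply: Sd.
  rewrite -sum1_card big_distrl /= -natz natr_sum ler_sum // => i _.
  by rewrite dE mul1n natz -ltzD1; have := @ltz_pmod (w1 i) q; lia.
apply: le_trans (lerD wd (ler_wpM2r _ wz')) _ => //.
rewrite -PoszM -PoszD lez_nat big_distrl /=.
apply: leq_trans (leq_add (leq_mul cardJ (leqnn _)) (leqnn _)) _.
(* The count is made modulus by modulus: (q - 1) + q (n k / q - 1) = n k - 1 when q divides
   [n k]. *)
rewrite -sum1_card big_distrl /= big_mkcond -big_split /=; apply: leq_sum => k _.
rewrite inE /n'; case: ifP => [qn|]; have [e|_] := q_dvd k.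
- by rewrite e dvdn1 in qn; rewrite (eqP qn) in q_gt1.
- have := n_gt0 k; rewrite -{1 3}(divnK qn); case: (n k %/ q)%N => [|c]; nia.
- by rewrite e.
- by move=> qn; have [e|] := q_dvd k; rewrite ?e ?qn.
Qed.


(** * Weights of residues and lifting to the lattice *)

Definition residues N m : {ffun I -> int} := [ffun i => (m i %% N%:Z)%Z].

Lemma residues_ge0 N m i : (0 < N)%N -> 0 <= residues N m i.
Proof. by move=> N_gt0; rewrite ffunE modz_ge0 //; lia. Qed.

Lemma supported_residues N S m : supported S m -> supported S (residues N m).
Proof. by move=> Sm i iS; rewrite ffunE Sm // mod0z. Qed.

Lemma residuesE N m : exists z, m = residues N m + z *~ N.
Proof.
exists [ffun i => (m i %/ N%:Z)%Z].
by apply/ffunP => i; rewrite ffunE mulrzffunE !ffunE addrC -divz_eq.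
Qed.

Lemma residues_mod N m i : (N%:Z %| m i - residues N m i)%Z.
Proof. by apply/dvdzP; exists (m i %/ N)%Z; rewrite ffunE {1}(divz_eq (m i) N) addrK. Qed.

(** In each coordinate the residues of [m i] and [- m i] add up to 0 or N. *)
Lemma weight_residuesN N S m : (0 < N)%N -> supported S m ->
  weight (residues N m) + weight (residues N (- m)) <= (#|S| * N)%N.
Proof.
move=> N_gt0 Sm; rewrite -weightD /weight (bigID (mem S)) /=.
rewrite [X in _ + X]big1 ?addr0 => [|i iS]; last first.
  by rewrite !ffunE Sm // oppr0 mod0z addr0.
rewrite -sum1_card big_distrl /= -natz natr_sum ler_sum // => i _.
rewrite !ffunE mul1n natz.
have N_gt0' : 0 < N%:Z by lia.
have := ltz_pmod (m i) N_gt0'; have := ltz_pmod (- m i) N_gt0'.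
have := divz_eq (m i) N; have := divz_eq (- m i) N.
set r := (m i %% N)%Z; set r' := (- m i %% N)%Z.
set c := (m i %/ N)%Z; set c' := (- m i %/ N)%Z => e' e lt' lt.
have sumE : r + r' = - (c + c') * N%:Z by lia.
have : - (c + c') * N%:Z < 2 * N%:Z by lia.
rewrite (ltr_pM2r N_gt0') => lt2.
by rewrite sumE -[leRHS]mul1r (ler_pM2r N_gt0'); lia.
Qed.

(** One of m and - m has residues of weight at most half of [#|S| * N], so a property stable under
    sign need only be checked there. *)
Lemma residues_ind (Q : {ffun I -> int} -> Prop) N S m :
    (0 < N)%N -> supported S m ->
    (forall w, supported S w -> Q (- w) -> Q w) ->
    (forall w, supported S w ->
       2 * weight (residues N w) <= (#|S| * N)%N -> Q w) ->
  Q m.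
Proof.
move=> N_gt0 Sm QN Qm; have le2 := weight_residuesN N_gt0 Sm.
have [le|gt] := lerP (2 * weight (residues N m)) (#|S| * N)%N; first exact: Qm.
apply: QN => //; apply: (Qm (- m)); first exact: (subgroupN (supported_subgroup S) Sm).
lia.
Qed.
(** With m = r + N w, the vector w is replaced by a short representative for the moduli lcm(n k, N)
    / N; scaled by N, its weight is at most the sum of the lcm(n k, N) - N. *)
Lemma lift_representative n N S m r : (0 < N)%N -> (forall k, 0 < n k)%N ->
    (forall k l, (n k %| n l) || (n l %| n k))%N -> zero_sum n m ->
    supported S m -> supported S r -> (forall i, 0 <= r i) ->
    (forall i, (N%:Z %| m i - r i)%Z) ->
  exists x z, [/\ forall i, 0 <= x i, supported S x, zero_sum n x,
    m = x + z *~ N & weight x <= weight r + (\sum_k (lcmn (n k) N - N))%N%:Z].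
Proof.
move=> N_gt0 n_gt0 chain Km Sm Sr r_ge0 mr.
pose w := [ffun i => ((m i - r i) %/ N%:Z)%Z].
have wE : m = r + w *~ N.
  apply/ffunP => i; rewrite ffunE mulrzffunE ffunE divzK ?mr //; ring.
have [|||w' [w'_ge0 Sw' Kw' ww']] :=
  @short_representative (fun k => lcmn (n k) N %/ N)%N S w.
- by move=> k; rewrite divn_gt0 // dvdn_leq ?dvdn_lcmr // lcmn_gt0 n_gt0.
- move=> k l; rewrite -(dvdn_pmul2r N_gt0) -[X in _ || X](dvdn_pmul2r N_gt0).
  rewrite !divnK ?dvdn_lcmr // !dvdn_lcm !dvdn_lcmr !andbT.
  by case/orP: (chain k l) => h; rewrite (dvdn_trans h (dvdn_lcml _ _)) ?orbT.
- by move=> i iS; rewrite ffunE Sm // Sr // subrr div0z.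
exists (r + w' *~ N), (w - w'); split.
- by move=> i; rewrite ffunE mulrzffunE addr_ge0 ?mulr_ge0.
- apply: (subgroupD (supported_subgroup S)) => //.
  exact: (subgroupMz (supported_subgroup S)).
- have -> : r + w' *~ N = m - (w - w') *~ N.
    by apply/ffunP => i; rewrite wE !(ffunE, mulrzffunE); ring.
  apply: (zero_sum_subgroup n).2 => //; exact/zero_sum_scale.
- by rewrite {1}wE; apply/ffunP => i; rewrite !(ffunE, mulrzffunE); ring.
rewrite weightD weightMz lerD2l; apply: le_trans (ler_wpM2r _ ww') _ => //.
rewrite -PoszM lez_nat big_distrl /=; apply: leq_sum => k _.
by rewrite -subn1 mulnBl mul1n divnK ?dvdn_lcmr.
Qed.

(** Unless q^e divides s, write s = u q^f with f < e and u prime to q; t inverts u modulo q^e, and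
    rho = q^f. *)
Lemma multiple_mod_primepower q e (s : int) : prime q -> (0 < e)%N ->
  exists (t rho : int), [/\ ~~ (q%:Z %| t)%Z, 0 <= rho <= (q ^ e.-1)%N &
    ((q ^ e)%N%:Z %| s * t - rho)%Z].
Proof.
move=> q_pr e_gt0; have q_gt1 := prime_gt1 q_pr.
have q_neq1 : ~~ (q%:Z %| 1%R)%Z by rewrite dvdzE dvdn1; case: (q) q_gt1 => [|[]].
have [es|es] := boolP ((q ^ e)%N%:Z %| s)%Z.
  by exists 1, 0; rewrite mulr1 subr0; split.
have s_neq0 : s != 0 by apply: contraNneq es => ->; rewrite dvdz0.
pose f := logn q `|s|; have f_lt : (f < e)%N.
  by rewrite ltnNge -pfactor_dvdn ?absz_gt0.
have [u su] : exists u : int, s = u * (q ^ f)%N%:Z.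
  by apply/dvdzP; rewrite dvdzE pfactor_dvdnn.
have qu : ~~ (q%:Z %| u)%Z.
  apply/negP => /dvdzP[v uv].
  have : ((q ^ f.+1)%N%:Z %| s)%Z.
    by apply/dvdzP; exists v; rewrite su uv expnS PoszM mulrA.
  by rewrite dvdzE pfactor_dvdn ?absz_gt0 // ltnn.
have cop : coprimez (q ^ e)%N u.
  by rewrite coprimezE coprimeXl // prime_coprime // -dvdzE.
have [a' [b]] := Bezoutz (q ^ e)%N u; rewrite (eqP cop) => ab.
have {}ab : a' * (q ^ e)%N%:Z + b * u = 1 := ab.
exists b, (q ^ f)%N%:Z; split.
- apply: contra q_neq1 => qb; rewrite -ab rpredD //.
    by apply: dvdz_mull; rewrite dvdzE dvdn_exp.
  exact: dvdz_mulr.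
- by rewrite lez_nat /= leq_exp2l // -ltnS prednK.
- apply/dvdzP; exists (- a' * (q ^ f)%N%:Z); rewrite su.
  have -> : u * (q ^ f)%N%:Z * b - (q ^ f)%N%:Z = (b * u - 1) * (q ^ f)%N%:Z by ring.
  by rewrite -ab; ring.
Qed.

Lemma weight_residues_mod N m : (N%:Z %| weight m - weight (residues N m))%Z.
Proof.
have [z e] := residuesE N m; apply/dvdzP; exists (weight z).
by rewrite {1}e weightD weightMz; ring.
Qed.

(* The weights of the residues of t y and - t y add up to at most 5 q ^ e;
   as they are congruent to rho and - rho, one of them is at most
   2 q ^ e + rho. *)
Lemma small_residues q e S y : prime q -> (0 < e)%N -> (#|S| <= 5)%N ->
    supported S y ->
  exists2 t : int, ~~ (q%:Z %| t)%Z &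
    weight (residues (q ^ e) (y *~ t)) <= (2 * q ^ e + q ^ e.-1)%N.
Proof.
move=> q_pr e_gt0 cardS Sy.
have [t [rho [qt rho_bnd hrho]]] := multiple_mod_primepower (weight y) q_pr e_gt0.
have Q_gt0 : (0 < q ^ e)%N by rewrite expn_gt0 prime_gt0.
have := @weight_residuesN (q ^ e) S (y *~ t) Q_gt0.
move/(_ (subgroupMz (supported_subgroup S) t Sy)).
have := weight_residues_mod (q ^ e) (y *~ t).
have := weight_residues_mod (q ^ e) (y *~ (- t)).
rewrite mulrNz; set s := weight (residues _ (y *~ t)).
set s' := weight (residues _ (- (y *~ t))).
rewrite -mulrNz !weightMz => /dvdzP[c' hs'] /dvdzP[c hs] le5.
have {}le5 : s + s' <= 5 * (q ^ e)%N%:Z.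
  by apply: le_trans le5 _; rewrite -PoszM lez_nat leq_mul2r cardS orbT.
case/dvdzP: hrho => d hd.
have [le2|gt2] := lerP s ((2 * q ^ e)%N%:Z + rho).
  by exists t => //; rewrite -/s; lia.
exists (- t); first by rewrite dvdzE abszN -dvdzE.
rewrite mulrNz -/s'; move: hs hs' hd le5 gt2 Q_gt0.
move: (q ^ e)%N => Q hs hs' hd le5 gt2 Q_gt0.
have Qpos : 0 < Q%:Z by lia.
(* Here s - rho = (d - c) Q exceeds 2 Q, hence is at least 3 Q, which leaves at most 2 Q for s'. *)
have : 2 * Q%:Z < (d - c) * Q%:Z by lia.
rewrite (ltr_pM2r Qpos) => gt_dc.
have : 3 * Q%:Z <= (d - c) * Q%:Z by rewrite (ler_pM2r Qpos); lia.
lia.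
Qed.

End Lattice.

(** * Four moduli *)

Lemma dvdn_chain (n : nat -> nat) k l :
  (forall j, n j %| n j.+1)%N -> (k <= l)%N -> (n k %| n l)%N.
Proof.
move=> n_dvd /subnK <-; elim: (l - k)%N => // d IH.
by rewrite addSn; apply: dvdn_trans IH _.
Qed.

Section RankFour.
(* n 0, ..., n 3 are the numbers n1, ..., n4 of the theorem. *)
Variables (I : finType) (a : 'I_4 -> I -> int) (n : nat -> nat).
Hypothesis n_gt0 : forall k, (0 < n k)%N.
Hypothesis n_dvd : forall k, (n k %| n k.+1)%N.
Variables (P : {ffun I -> int} -> Prop) (D : nat).
Hypothesis subP : subgroup P.
Let nn (k : 'I_4) : nat := n k.
Notation zs := (zero_sum a nn).
Hypothesis shortP :
  forall x, zs x -> (forall i, 0 <= x i) -> weight x <= D -> P x.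

Let n_chain k l : (k <= l)%N -> (n k %| n l)%N := dvdn_chain n_dvd.

Let nn_chain (k l : 'I_4) : (nn k %| nn l)%N || (nn l %| nn k)%N.
Proof. by case/orP: (leq_total k l) => /n_chain ->; rewrite ?orbT. Qed.

Lemma lcm_excess j : (j < 4)%N ->
  (\sum_k (lcmn (nn k) (n j) - n j) = \sum_(k < 4 | (j < k)%N) (n k - n j))%N.
Proof.
move=> j_lt4; rewrite [RHS]big_mkcond; apply: eq_bigr => k _.
case: ltnP => [/ltnW|] /n_chain h.
  by rewrite (lcmn_idPl h).
by rewrite (lcmn_idPr h) subnn.
Qed.

Lemma card_not_dvd j : (j < 4)%N ->
  (#|[set k : 'I_4 | ~~ (nn k %| n j)]| <= 3 - j)%N.
Proof.
move=> j_lt4; apply: leq_trans (_ : #|[set k : 'I_4 | (j < k)%N]| <= _)%N.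
  apply/subset_leq_card/subsetP => k; rewrite !inE ltnNge.
  by apply: contra => /n_chain.
rewrite -sum1dep_card -(big_mkord (fun k => j < k)%N (fun=> 1%N)).
by case: j j_lt4 => [|[|[|[|j]]]] // _; rewrite unlock.
Qed.

(** After division by N at most c moduli differ from 1, so at every prime supports of size c + 1
    suffice. *)
Lemma small_support_generates N c : (0 < N)%N ->
    (#|[set k : 'I_4 | ~~ (nn k %| N)]| <= c)%N ->
    (forall (S : {set I}) m, (#|S| <= c.+1)%N -> zs (m *~ N) ->
       supported S m -> P (m *~ N)) ->
  forall m, zs (m *~ N) -> P (m *~ N).
Proof.
move=> N_gt0 cardc PS m Km.
pose P' w := P (w *~ N).
have subP' : subgroup P'.
  split=> [|x y Px Py]; first by rewrite /P' mul0rz; exact: subP.1.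
  by rewrite /P' mulrzBl; exact: subP.2.
apply: (@subgroup_local _ P') => // q q_pr.
apply: (@local_small_support _ _ a P' q (fun k => lcmn (nn k) N %/ N)%N c) => //.
- apply: leq_trans cardc; apply/subset_leq_card/subsetP => k; rewrite !inE.
  apply: contraTN => kN; suff -> : lcmn (nn k) N = N.
    by rewrite divnn N_gt0 dvdn1; case: (q) q_pr => [|[]].
  by apply/lcmn_idPr.
- by move=> S w cS /zero_sum_scale Kw Sw; apply: (PS S) => //; apply: Kw.
- exact/zero_sum_scale.
Qed.

Hypothesis D_ge : forall q, prime q -> (q %| n 0)%N ->
  (n 1 %/ q + n 2 + n 3 <= D)%N.
Hypothesis n0_gt1 : (1 < n 0)%N.

Let D_ge' : (n 2 + n 3 <= D)%N.
Proof.
apply: leq_trans (D_ge (pdiv_prime n0_gt1) (pdiv_dvd _)).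
by rewrite -addnA leq_addl.
Qed.

(** The vectors with single nonzero entry [n 3] are zero-sum and of weight at most D. *)
Lemma multiples_n3_generated z : P (z *~ n 3).
Proof.
pose u (i : I) := [ffun j => if j == i then (n 3)%:Z else 0].
have uE i j : j != i -> u i j = 0 by rewrite ffunE => /negPf->.
have uii i : u i i = n 3 by rewrite ffunE eqxx.
have -> : z *~ n 3 = \sum_i u i *~ z i.
  apply/ffunP => j; rewrite mulrzffunE sum_ffunE (bigD1 j) //= big1 => [|i ij].
    by rewrite addr0 mulrzffunE uii mulrC.
  by rewrite mulrzffunE uE ?mul0r // eq_sym.
apply: big_ind => [|x y|i _]; [exact: subP.1 | exact: subgroupD |].
apply: subgroupMz => //; apply: shortP => [k|j|].
- rewrite /pairing (bigD1 i) //= big1 => [|j ij]; last by rewrite uE ?mulr0.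
  rewrite addr0 uii; apply: dvdz_mull; rewrite dvdzE.
  by apply: n_chain; rewrite -ltnS.
- by rewrite ffunE; case: ifP.
- rewrite /weight (bigD1 i) //= big1 => [|j ij]; last by rewrite uE.
  by rewrite uii addr0 lez_nat (leq_trans (leq_addl _ _) D_ge').
Qed.

(** Only the last modulus survives division by [n 2], so two coordinates suffice. With n 3 = n 2 d,
    up to sign their residues modulo d weigh at most d, which after scaling is at most [n 3]. *)
Lemma multiples_n2_generated m : zs (m *~ n 2) -> P (m *~ n 2).
Proof.
apply: (small_support_generates (n_gt0 2) (card_not_dvd (isT : 2 < 4)%N)).
have [d n3E] : exists d, n 3 = (n 2 * d)%N.
  by case/dvdnP: (n_dvd 2) => d ->; exists d; rewrite mulnC.
have d_gt0 : (0 < d)%N by have := n_gt0 3; rewrite n3E muln_gt0 => /andP[].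
move=> S {}m cardS Km Sm; move: Km.
pose Q m := zs (m *~ n 2) -> P (m *~ n 2).
apply: (residues_ind (N := d) (Q := Q) _ Sm) => //.
  move=> w _ Pw Kw; rewrite -[w]opprK mulNrz; apply: subgroupN => //; apply: Pw.
  by rewrite mulNrz; apply: (subgroupN (zero_sum_subgroup _ _)).
move=> w Sw le2 Kw; have [z wE] := residuesE d w.
have Pz : P (z *~ d *~ n 2).
  by rewrite -mulrzA -PoszM mulnC -n3E; apply: multiples_n3_generated.
have Kz : zs (z *~ d *~ n 2).
  rewrite -mulrzA -PoszM mulnC -n3E => k; rewrite raddfMz /= mulrzz.
  by apply: dvdz_mull; rewrite dvdzE; apply: n_chain; rewrite -ltnS.
rewrite wE mulrzDl in Kw *; apply: subgroupD => //; apply: shortP.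
- by rewrite -[X in zs X](addrK (z *~ d *~ n 2)); apply: (zero_sum_subgroup _ _).2.
- by move=> i; rewrite mulrzffunE mulr_ge0 ?residues_ge0.
rewrite weightMz; have : (#|S| * d <= 2 * d)%N by rewrite leq_mul2r cardS orbT.
have := D_ge'; move: le2; rewrite n3E => *; nia.
Qed.

(** Up to sign the residues modulo [n 2] weigh at most 2 n 2, and lifting costs n 3 - n 2. The
    remainder is a multiple of [n 2] in the lattice. *)
Lemma support4_generated (S : {set I}) m :
  (#|S| <= 4)%N -> zs m -> supported S m -> P m.
Proof.
move=> cardS Km Sm; move: Km.
apply: (residues_ind (N := n 2) (Q := fun m => zs m -> P m) _ Sm) => //.
  move=> w _ Pw Kw; rewrite -[w]opprK; apply: subgroupN => //; apply: Pw.
  exact: (subgroupN (zero_sum_subgroup _ _)).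
move=> w Sw le2 Kw.
have [|||x [z [x_ge0 _ Kx xE wx]]] :=
  lift_representative (n_gt0 2) _ nn_chain Kw Sw (supported_residues (n 2) Sw).
- by move=> k; apply: n_gt0.
- by move=> i; apply: residues_ge0.
- by move=> i; apply: residues_mod.
have Px : P x.
  apply: shortP => //; apply: le_trans wx _; rewrite lcm_excess //.
  rewrite big_mkcond !big_ord_recl big_ord0 /=.
  have : (#|S| * n 2 <= 4 * n 2)%N by rewrite leq_mul2r cardS orbT.
  have := D_ge'; have := n_chain (isT : 2 <= 3)%N => /(dvdn_leq (n_gt0 3)).
  rewrite /bump /= !addn0 !add1n; lia.
rewrite xE; apply: subgroupD => //; apply: multiples_n2_generated.
suff -> : z *~ n 2 = w - x by apply: (zero_sum_subgroup _ _).2.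
by rewrite xE addrAC subrr add0r.
Qed.

Lemma short_generates m : zs m -> P m.
Proof.
move=> Km; apply: (subgroup_local subP) => q q_pr.
(* If q does not divide [n 0], at most three moduli are divisible by q, and four coordinates
   suffice. *)
have [qn0|qn0] := boolP (q %| n 0)%N; last first.
  apply: (local_small_support (n := nn) (c := 3) subP q_pr _ _ Km);
    last exact: support4_generated.
  apply: leq_trans (_ : #|[set k : 'I_4 | (0 < k)%N]| <= _)%N.
    apply/subset_leq_card/subsetP => k; rewrite !inE; apply: contraTT.
    by rewrite -eqn0Ngt /nn => /eqP->.
  by rewrite -sum1dep_card -(big_mkord (fun k => 0 < k)%N (fun=> 1%N)) unlock.
have [J [_ cardJ HJ]] := local_generators a [set: I] nn q_pr.
have {}cardJ : (#|J| <= 4)%N.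
  by apply: leq_trans cardJ (leq_trans (max_card _) _); rewrite card_ord.
apply: (local_descent (n := nn) (J := J) subP q_pr _ _ Km) => [w|i iJ].
  exact: support4_generated.
have [y [Ky Sy yi]] := HJ i (in_setT i) iJ.
have qn1 : (q %| n 1)%N by apply: dvdn_trans qn0 (n_dvd 0).
pose e := logn q (n 1).
have e_gt0 : (0 < e)%N by rewrite logn_gt0 mem_primes q_pr n_gt0.
have [c q_c n1E] := pfactor_coprime q_pr (n_gt0 1); rewrite -/e in n1E.
have c_gt0 : (0 < c)%N by have := n_gt0 1; rewrite n1E muln_gt0 => /andP[].
have [|t qt le_t] := small_residues (S := i |: J) q_pr e_gt0 _ Sy.
  by rewrite cardsU1 iJ.
set r := residues _ _ in le_t.
have Sr : supported (i |: J) r.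
  exact/supported_residues/(subgroupMz (supported_subgroup _)).
have Q_gt0 : (0 < q ^ e)%N by rewrite expn_gt0 prime_gt0.
(* As n 1 = c q^e, the vector [r *~ c] is congruent to [y *~ t *~ c] modulo [n 1], and it weighs at
   most 2 n 1 + n 1 / q. *)
have [|||||||x [z [x_ge0 Sx Kx xE wx]]] := lift_representative
   (a := a) (N := n 1) (S := i |: J) (n := nn) (m := y *~ t *~ c) (r := r *~ c)
   _ _ nn_chain.
- exact: n_gt0.
- by move=> k; apply: n_gt0.
- by do 2 apply: (subgroupMz (zero_sum_subgroup _ _)).
- by do 2 apply: (subgroupMz (supported_subgroup _)).
- exact: (subgroupMz (supported_subgroup _)).
- by move=> j; rewrite mulrzffunE mulr_ge0 ?residues_ge0.
- move=> j; rewrite n1E !(mulrzffunE _ c) -mulrBl mulnC PoszM.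
  exact/dvdz_mul/dvdzz/residues_mod.
exists x; split=> //; last first.
(* The lift changes coordinate i by a multiple of [n 1], hence of q, while [y i], t and c are prime
   to q. *)
- apply/negP => qx; have : (q%:Z %| (y *~ t *~ c) i)%Z.
    rewrite xE ffunE; apply: rpredD => //; rewrite mulrzffunE.
    by apply: dvdz_mull; rewrite dvdzE.
  rewrite !mulrzffunE !prime_dvdzM // (negPf yi) (negPf qt) /= dvdzE /=.
  by apply/negP; rewrite -prime_coprime.
apply: shortP => //; apply: le_trans wx _; rewrite lcm_excess //.
rewrite big_mkcond !big_ord_recl big_ord0 /= /bump /= !addn0 !add1n.
apply: (@le_trans _ _ (n 1 %/ q + n 2 + n 3)%N%:Z); last by rewrite lez_nat D_ge.
have -> : (n 1 %/ q = c * q ^ e.-1)%N.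
  by rewrite n1E -{1}(prednK e_gt0) expnSr mulnA mulnK ?prime_gt0.
have le12 := dvdn_leq (n_gt0 2) (n_dvd 1).
have le13 := dvdn_leq (n_gt0 3) (n_chain (isT : 1 <= 3)%N).
have : weight (r *~ c) <= (2 * n 1 + c * q ^ e.-1)%N.
  rewrite weightMz; apply: le_trans (ler_wpM2r _ le_t) _ => //.
  by rewrite -PoszM lez_nat n1E; lia.
move: (c * q ^ e.-1)%N (weight (r *~ c)) le12 le13; clear; lia.
Qed.
End RankFour.

(** * Modules of abelian groups *)

Lemma prim_root_exists (F : numClosedFieldType) n :
  (0 < n)%N -> exists z : F, n.-primitive_root z.
Proof.
move=> n_gt0; have [r Dp] := closed_field_poly_normal ('X^n - 1 : {poly F}).
rewrite (monicP _) ?monicXnsubC // scale1r in Dp.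
have rn1 : all n.-unity_root r by apply/allP => z; rewrite -root_prod_XsubC -Dp.
have sz_r : (n < (size r).+1)%N.
  by rewrite -(size_prod_XsubC r id) -Dp size_XnsubC.
have [|z] := hasP (has_prim_root n_gt0 rn1 _ sz_r); last by exists z.
by rewrite -separable_prod_XsubC -Dp separable_Xn_sub_1 // pnatr_eq0 -lt0n.
Qed.

(** The minimal polynomial divides X^N - 1, which splits with simple roots. The power is an iterated
    product so that dimension 0 is included. *)
Lemma finite_order_diagonalizable (F : numClosedFieldType) n (A : 'M[F]_n) N :
  (0 < N)%N -> iter N (mulmx A) 1%:M = 1%:M -> diagonalizable A.
Proof.
case: n A => [|n] A N_gt0 AN.
  by exists 1%:M; rewrite ?unitmx1 //; apply/is_diag_mxP => -[].
have {}AN : A ^+ N = 1.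
  by rewrite -[RHS]AN; elim: (N) => //= k IH; rewrite exprS IH.
apply/diagonalizableP.
have [r Dp] := closed_field_poly_normal ('X^N - 1 : {poly F}).
rewrite (monicP _) ?monicXnsubC // scale1r in Dp; exists r.
  by rewrite -separable_prod_XsubC -Dp separable_Xn_sub_1 // pnatr_eq0 -lt0n.
rewrite -Dp; apply/mxminpoly_minP.
by rewrite rmorphB rmorphXn /= horner_mx_X rmorph1 AN subrr.
Qed.

Section AbelianRepresentations.
Variables (F : numClosedFieldType) (gT : finGroupType) (G : {group gT}).

Lemma abelian_diagonalization n (rG : mx_representation F G n) : abelian G ->
  exists Q (chi : gT -> 'I_n -> F), Q \in unitmx /\
    forall g, g \in G -> Q *m rG g = diag_mx (\row_i chi g i) *m Q.
Proof.
move=> abG.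
have [|Q Qu /allP/= diagQ] := (codiagonalizableP [seq rG g | g in G]).1.
  split=> [_ _ /imageP[g Gg ->] /imageP[h Gh ->]|_ /imageP[g Gg ->]].
    by rewrite /comm_mx -!repr_mxM // (centsP abG g Gg h Gh).
  apply: (@finite_order_diagonalizable _ _ _ #|G|) => //.
  have gX k : iter k (mulmx (rG g)) 1%:M = rG (g ^+ k)%g.
    elim: k => [|k IH]; first by rewrite expg0 repr_mx1.
    by rewrite iterS IH expgS repr_mxM // groupX.
  by rewrite gX expg_cardG // repr_mx1.
have dP g : exists d : 'I_n -> F,
    g \in G -> Q *m rG g = diag_mx (\row_i d i) *m Q.
  have [Gg|] := boolP (g \in G); last by exists (fun=> 0).
  have /(similar_diagLR Qu)[d rgE] := diagQ _ (image_f rG Gg).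
  exists (d 0) => _; rewrite rgE conjVmx // !mulmxA mulmxV // mul1mx.
  by congr (diag_mx _ *m _); apply/rowP => i; rewrite mxE.
by have /boolp.choice[chi Hchi] := dP; exists Q, chi; split.
Qed.

Variable n : nat.

Definition trivial_on (chi : gT -> 'I_n -> F) (m : 'I_n -> nat) : Prop :=
  forall g, g \in G -> \prod_i chi g i ^+ m i = 1.

(** Translation by g0 permutes G and multiplies the sum by [psi g0], which is not 1. *)
Lemma sum_character (psi : gT -> F) g0 :
    {in G &, {morph psi : g h / (g * h)%g >-> g * h}} -> g0 \in G ->
  psi g0 != 1 -> \sum_(g in G) psi g = 0.
Proof.
move=> psiM Gg0 psi1; apply/eqP; apply: contraNT psi1 => sum_neq0.
apply/eqP/(mulIf sum_neq0); rewrite mul1r [RHS](reindex_inj (mulgI g0)) mulr_sumr.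
rewrite [RHS](eq_bigl (mem G)) => [|g]; last by rewrite /= groupMl.
by apply: eq_bigr => g Gg; rewrite psiM.
Qed.

(* Averaging over G kills the monomials on which G acts by a nontrivial
   character. *)
Lemma invariant_eval_eq (chi : gT -> 'I_n -> F) (p : {mpoly F[n]})
    (z z' : 'I_n -> F) :
    (forall i, {in G &, {morph chi^~ i : g h / (g * h)%g >-> g * h}}) ->
    (forall g v, g \in G -> p.@[fun i => chi g i * v i] = p.@[v]) ->
    (forall m : 'X_{1..n}, m \in msupp p -> trivial_on chi m ->
       \prod_i z i ^+ m i = \prod_i z' i ^+ m i) ->
  p.@[z] = p.@[z'].
Proof.
move=> chiM p_inv eq_z.
have G_neq0 : #|G|%:R != 0 :> F by rewrite pnatr_eq0 -lt0n cardG_gt0.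
have avg v : #|G|%:R * p.@[v] = \sum_(m <- msupp p)
    p@_m * \prod_i v i ^+ m i * \sum_(g in G) \prod_i chi g i ^+ m i.
  rewrite mulr_natl -sumr_const.
  rewrite (eq_bigr (fun g => p.@[fun i => chi g i * v i])) => [|g Gg];
    last by rewrite p_inv.
  under eq_bigr => g _ do rewrite mevalE.
  rewrite exchange_big /=; apply: eq_bigr => m _; rewrite mulr_sumr.
  apply: eq_bigr => g _; rewrite -mulrA -big_split /=; congr (_ * _).
  by apply: eq_bigr => i _; rewrite exprMn mulrC.
apply: (mulfI G_neq0); rewrite !avg; apply: eq_big_seq => m m_supp.
have [triv|/boolp.existsNP[g /boolp.not_implyP[Gg /eqP chi_g]]] :=
  boolp.pselect (trivial_on chi m).
  by rewrite eq_z.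
rewrite (sum_character _ Gg chi_g) ?mulr0 // => h k Gh Gk.
by rewrite -big_split /=; apply: eq_bigr => i _; rewrite chiM // exprMn.
Qed.

End AbelianRepresentations.

(** * Invariants in eigencoordinates *)

Section Modules.
Variables (R : realType) (gT : finGroupType) (G : {group gT}) (n : nat).
Variable rG : mx_representation R[i]%C G n.
Local Notation C := R[i]%C.

Variables (Q : 'M[C]_n) (chi : gT -> 'I_n -> C).
Hypothesis Q_unit : Q \in unitmx.
Hypothesis diagQ :
  forall g, g \in G -> Q *m rG g = diag_mx (\row_i chi g i) *m Q.

Lemma diagonal_characterM i :
  {in G &, {morph chi^~ i : g h / (g * h)%g >-> g * h}}.
Proof.
move=> g h Gg Gh.
have : diag_mx (\row_j chi (g * h)%g j) = diag_mx (\row_j (chi g j * chi h j)).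
  apply: (can_inj (mulmxK Q_unit)); rewrite -diagQ ?groupM // repr_mxM //.
  rewrite mulmxA diagQ // -mulmxA diagQ // mulmxA mulmx_diag.
  by congr (diag_mx _ *m _); apply/rowP => j; rewrite !mxE.
by move/matrixP/(_ i i); rewrite !mxE eqxx.
Qed.

Lemma invariant_coordinates_eq (h : {mpoly C[n]}) (v1 v2 : 'cV[C]_n) :
    Defs.invariant rG h ->
    (forall m : 'X_{1..n}, trivial_on G chi m ->
      \prod_i (Q *m v1) i 0 ^+ m i = \prod_i (Q *m v2) i 0 ^+ m i) ->
  peval h v1 = peval h v2.
Proof.
move=> inv_h eq12.
(* p is h expressed in the coordinates [Q *m v], in which G acts diagonally. *)
pose p := h \mPo [tuple \sum_(j < n) invmx Q i j *: 'X_j | i < n].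
have pE (z : 'I_n -> C) : p.@[z] = peval h (invmx Q *m \col_i z i).
  rewrite /p comp_mpoly_meval; apply: meval_eq => i.
  rewrite tnth_mktuple raddf_sum /= mxE; apply: eq_bigr => j _.
  by rewrite mevalZ mevalXU mxE.
have hE v : peval h v = p.@[fun i => (Q *m v) i 0].
  rewrite pE; congr (peval h _); rewrite -[LHS](mulKmx Q_unit).
  by congr (_ *m _); apply/colP => i; rewrite [RHS]mxE.
rewrite !hE; apply: (invariant_eval_eq diagonal_characterM) => [g v Gg|m _];
  last exact: eq12.
have inv_eval w : peval h (rG g *m w) = peval h w.
  have := peval_pact rG g^-1%g h w.
  have Gg' : g^-1%g \in G by rewrite groupV.
  rewrite (inv_h _ Gg') /mact invgK; exact: esym.
rewrite !pE -[RHS]inv_eval; congr (peval h _).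
apply: (canLR (mulKmx Q_unit)).
rewrite mulmxA diagQ // -mulmxA mulKVmx // mul_diag_mx.
by apply/colP => i; rewrite !mxE.
Qed.

Definition linear_form i : {mpoly C[n]} := \sum_j Q i j *: 'X_j.

Definition invariant_monomial (m : 'I_n -> nat) : {mpoly C[n]} :=
  \prod_i linear_form i ^+ m i.

Lemma peval_invariant_monomial m v :
  peval (invariant_monomial m) v = \prod_i (Q *m v) i 0 ^+ m i.
Proof.
rewrite /peval /invariant_monomial rmorph_prod; apply: eq_bigr => i _.
rewrite rmorphXn /linear_form raddf_sum /= mxE; congr (_ ^+ _).
by apply: eq_bigr => j _; rewrite mevalZ mevalXU.
Qed.

Lemma invariant_monomial_homog m :
  invariant_monomial m \is (\sum_i m i)%N.-homog.
Proof.
apply: (big_ind2 (fun (p : {mpoly C[n]}) d => p \is d.-homog)) => [|p d q e|i _].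
- exact: dhomog1.
- exact: dhomogM.
have form : linear_form i \is 1.-homog.
  by apply: rpred_sum => j _; apply: rpredZ; rewrite dhomogX /= mdeg1.
by have := dhomogMn (m i) form; rewrite mul1n.
Qed.

Lemma invariant_monomialP m :
  trivial_on G chi m -> Defs.invariant rG (invariant_monomial m).
Proof.
move=> triv g Gg; have Gg' : g^-1%g \in G by rewrite groupV.
have form i : pact rG g (linear_form i) = chi g^-1%g i *: linear_form i.
  rewrite /pact /linear_form raddf_sum /= scaler_sumr.
  under eq_bigr => j _ do
    rewrite comp_mpolyZ comp_mpolyXU -tnth_nth tnth_mktuple scaler_sumr.
  rewrite exchange_big /=; apply: eq_bigr => j _.
  under eq_bigr => k _ do rewrite scalerA.
  rewrite -scaler_suml scalerA; congr (_ *: _).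
  have /matrixP/(_ i j) := diagQ Gg'; rewrite mul_diag_mx !mxE => <-.
  by [].
rewrite /invariant_monomial /pact rmorph_prod /=.
under eq_bigr => i _ do rewrite rmorphXn /= -/(pact rG g _) form exprZn.
by rewrite scaler_prod triv // scale1r.
Qed.

(** All homogeneous invariants of degree at most d are taken. If none separates two points, the
    short invariant monomials agree there, hence all invariant monomials, hence all invariants. *)
Lemma separated_if_monomials d :
    (forall z z' : 'I_n -> C,
      (forall m : 'I_n -> nat, (\sum_i m i <= d)%N -> trivial_on G chi m ->
         \prod_i z i ^+ m i = \prod_i z' i ^+ m i) ->
      forall m : 'I_n -> nat, trivial_on G chi m ->
         \prod_i z i ^+ m i = \prod_i z' i ^+ m i) ->
  separated_in_degree rG d.
Proof.
move=> Hd.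
pose S (f : {mpoly C[n]}) :=
  Defs.invariant rG f /\ exists2 k, (k <= d)%N & f \is k.-homog.
exists S; last by move=> f [].
split=> [f []//|v1 v2 [h inv_h neq_h]].
have [//|no_f] := boolp.pselect (exists2 f, S f & peval f v1 <> peval f v2).
case: neq_h; apply: invariant_coordinates_eq => // m; apply: Hd => {}m le_d triv.
rewrite -!peval_invariant_monomial; apply: boolp.contrapT => neq; case: no_f.
exists (invariant_monomial m) => //; split; first exact: invariant_monomialP.
by exists (\sum_i m i)%N => //; exact: invariant_monomial_homog.
Qed.

End Modules.

(** * Coordinates on a direct product of cyclic groups *)

Section Coordinates.
Variables (gT : finGroupType) (G : {group gT}).

Lemma prodg_mul (I : finType) (u v : I -> gT) : abelian G ->
    (forall i, u i \in G) -> (forall i, v i \in G) ->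
  (\prod_i (u i * v i) = (\prod_i u i) * (\prod_i v i))%g.
Proof.
move=> abG Gu Gv.
pose K (s t w : gT) := [/\ t \in G, w \in G & s = (t * w)%g].
suff [] : K (\prod_i (u i * v i))%g (\prod_i u i)%g (\prod_i v i)%g by [].
apply: big_rec3 => [|i s t w _ [Gt Gw ->]]; first by split; rewrite ?group1 ?mulg1.
split; rewrite ?groupM // !mulgA; congr (_ * _)%g.
by rewrite -!mulgA; congr (_ * _)%g; apply: (centsP abG).
Qed.

(** The exponents [e g k] are chosen, and unique only modulo the order of the factor, so their laws
    are congruences. *)
Lemma cyclic_coordinates r (H : 'I_r -> {group gT}) : abelian G ->
    (\big[dprod/1]_k H k)%g = G -> (forall k, cyclic (H k)) ->
  exists (x : 'I_r -> gT) (e : gT -> 'I_r -> nat),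
    [/\ forall k, x k \in G, forall k, #[x k]%g = #|H k|,
        forall g, g \in G -> g = (\prod_k x k ^+ e g k)%g,
        forall g h k, g \in G -> h \in G ->
          e (g * h)%g k = e g k + e h k %[mod #|H k|] &
        forall j k, e (x j) k = (j == k) %[mod #|H k|]].
Proof.
move=> abG defG cycH.
have /boolp.choice[x Hx] : forall k, exists x, H k = <[x]>%g :> {set gT}.
  by move=> k; apply/cyclicP.
have ox k : #[x k]%g = #|H k| by rewrite Hx.
have sHG k : H k \subset G.
  by rewrite -(bigdprodWY defG) (bigD1 k) ?joing_subl.
have Gx k : x k \in G by apply: (subsetP (sHG k)); rewrite Hx cycle_id.
have uniqx (c d : 'I_r -> nat) :
    (\prod_k x k ^+ c k = \prod_k x k ^+ d k)%g -> forall k, c k = d k %[mod #|H k|].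
  move=> cd k.
  have Gc : (\prod_k x k ^+ c k)%g \in G.
    by apply: group_prod => l _; rewrite groupX.
  have [b [_ _ uniqb]] := mem_bigdprod defG Gc.
  have xH (f : 'I_r -> nat) l : (x l ^+ f l)%g \in H l by rewrite Hx mem_cycle.
  apply/eqP; rewrite -ox -eq_expg_mod_order.
  by rewrite (uniqb (fun l => x l ^+ c l)%g) // (uniqb (fun l => x l ^+ d l)%g).
have /boolp.choice[e He] : forall g, exists c : 'I_r -> nat,
    g \in G -> g = (\prod_k x k ^+ c k)%g.
  move=> g; have [Gg|] := boolP (g \in G); last by exists (fun=> 0%N).
  have [b [Hb gE _]] := mem_bigdprod defG Gg.
  have /boolp.choice[c Hc] : forall k, exists c, b k = (x k ^+ c)%g.
    by move=> k; apply/cycleP; rewrite -Hx Hb.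
  by exists c => _; rewrite gE; apply: eq_bigr => k _.
exists x, e; split=> // [g h k Gg Gh|j k].
  apply: (uniqx _ (fun k => e g k + e h k)%N); rewrite -He ?groupM //.
  rewrite {1}(He g Gg) {1}(He h Gh) -prodg_mul => // [|i|i]; rewrite ?groupX //.
  by apply: eq_bigr => i _; rewrite expgD.
apply: (uniqx _ (fun k => (j == k) : nat)); rewrite -He //.
rewrite (eq_bigr (fun k => if k == j then x k else 1%g)) => [|i _].
  by rewrite -big_mkcond big_pred1_eq.
by rewrite [i == j]eq_sym; case: (j == i); rewrite ?expg1 ?expg0.
Qed.
End Coordinates.

(** * The upper bound *)

Lemma prim_exprz_eq1 (F : fieldType) n (z : F) (d : int) :
  n.-primitive_root z -> (z ^ d == 1) = (n%:Z %| d)%Z.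
Proof.
move=> prim_z; rewrite dvdzE /=; case: d => d /=.
  by rewrite -exprnP (prim_order_dvd prim_z).
by rewrite NegzE -exprnN invr_eq1 (prim_order_dvd prim_z).
Qed.

Section Characters.
Variables (F : numClosedFieldType) (gT : finGroupType) (G : {group gT}).
Variables (r n : nat) (o : 'I_r -> nat) (x : 'I_r -> gT).
Hypothesis Gx : forall k, x k \in G.
Hypothesis x_gen : forall g, g \in G ->
  exists e : 'I_r -> nat, g = (\prod_k x k ^+ e k)%g.
Variables (zeta : 'I_r -> F) (a : 'I_r -> 'I_n -> int) (chi : gT -> 'I_n -> F).
Hypothesis prim_zeta : forall k, (o k).-primitive_root (zeta k).
Hypothesis chi1 : forall i, chi 1%g i = 1.
Hypothesis chiM :
  forall i, {in G &, {morph chi^~ i : g h / (g * h)%g >-> g * h}}.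
Hypothesis chix : forall k i, chi (x k) i = zeta k ^ a k i.

(** A character is trivial when it is trivial on the generators; at [x k] its value is [zeta k] to
    the k-th pairing. *)
Lemma trivial_on_zero_sum (m : 'I_n -> nat) :
  trivial_on G chi m <-> zero_sum a o [ffun i => (m i)%:Z].
Proof.
have xE k : \prod_i chi (x k) i ^+ m i
    = zeta k ^ pairing a k [ffun i => (m i)%:Z].
  have zeta_unit : zeta k \is a GRing.unit.
    by rewrite unitfE (prim_root_eq0 (prim_zeta k)) -lt0n (prim_order_gt0 (prim_zeta k)).
  rewrite /pairing (big_morph (exprz (zeta k)) (id1 := 1) (op1 := *%R)) //; last first.
    by move=> u v; rewrite expfzDr // -unitfE.
  by apply: eq_bigr => i _; rewrite ffunE chix -exprz_exp.
split=> [triv k|zs g Gg].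
  by rewrite -(prim_exprz_eq1 _ (prim_zeta k)) -xE triv.
pose psi g := \prod_i chi g i ^+ m i; rewrite -/(psi g).
have psiM h1 h2 : h1 \in G -> h2 \in G -> psi (h1 * h2)%g = psi h1 * psi h2.
  move=> Gh1 Gh2; rewrite /psi -big_split /=; apply: eq_bigr => i _.
  by rewrite chiM // exprMn.
have psi1 : psi 1%g = 1 by rewrite /psi big1 // => i _; rewrite chi1 expr1n.
have psix k : psi (x k) = 1.
  by apply/eqP; rewrite /psi xE (prim_exprz_eq1 _ (prim_zeta k)).
have [e ->] := x_gen Gg.
pose K h := h \in G /\ psi h = 1.
suff [] : K (\prod_k x k ^+ e k)%g by [].
have KM h1 h2 : K h1 -> K h2 -> K (h1 * h2)%g.
  by move=> [G1 e1] [G2 e2]; split; rewrite ?groupM // psiM // e1 e2 mulr1.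
have K1 : K 1%g by split; rewrite ?group1.
apply: (big_ind K) => // k _.
by elim: (e k) => // d IH; rewrite expgS; apply: KM => //; split.
Qed.
End Characters.

Section UpperBound.
Variables (F : numClosedFieldType) (n : nat -> nat) (D : nat).
Hypothesis n_gt0 : forall k, (0 < n k)%N.
Hypothesis n_dvd : forall k, (n k %| n k.+1)%N.
Hypothesis n0_gt1 : (1 < n 0)%N.
Hypothesis D_ge : forall q, prime q -> (q %| n 0)%N ->
  (n 1 %/ q + n 2 + n 3 <= D)%N.
Variables (I : finType) (a : 'I_4 -> I -> int).
Notation zs m := (zero_sum a (fun k : 'I_4 => n k) [ffun i => (m i)%:Z]).

Lemma short_monomials_separate (z z' : I -> F) :
    (forall m : I -> nat, (\sum_i m i <= D)%N -> zs m ->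
      \prod_i z i ^+ m i = \prod_i z' i ^+ m i) ->
  forall m : I -> nat, zs m -> \prod_i z i ^+ m i = \prod_i z' i ^+ m i.
Proof.
move=> eq_short m Km.
have n3D : (n 3 <= D)%N.
  apply: leq_trans (D_ge (pdiv_prime n0_gt1) (pdiv_dvd _)).
  exact: leq_addl.
(* The n 3-th power of a single variable is a short invariant monomial. *)
have eq0 i : (z i == 0) = (z' i == 0).
  have powE (y : I -> F) : \prod_j y j ^+ (if j == i then n 3 else 0%N) = y i ^+ n 3.
    by rewrite (bigD1 i) //= eqxx big1 ?mulr1 // => j /negPf->.
  suff e : z i ^+ n 3 = z' i ^+ n 3.
    by have := congr1 (eq_op^~ 0) e; rewrite /= !expf_eq0 n_gt0.
  rewrite -(powE z) -(powE z'); apply: eq_short.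
    by rewrite (bigD1 i) //= eqxx big1 ?addn0 // => j /negPf->.
  move=> k; rewrite /pairing (bigD1 i) //= big1 ?addr0 => [|j /negPf ji].
    rewrite ffunE eqxx; apply: dvdz_mull; rewrite dvdzE.
    by apply: dvdn_chain => //; rewrite -ltnS.
  by rewrite ffunE ji mulr0.
pose u i := if z i == 0 then 1 else z i / z' i.
(* On vanishing coordinates u is 1 and the weights are 0: entries there affect neither the products
   of u nor the lattice, so the index set need not be cut down. *)
pose a' k i : int := if z i == 0 then 0 else a k i.
have u_neq0 i : u i != 0.
  rewrite /u; case: ifP => [_|/negbT zi]; first exact: oner_neq0.
  by rewrite mulf_neq0 ?invr_neq0 // -eq0.
have pairingE k (w : {ffun I -> int}) :
    (forall i, z i == 0 -> w i = 0) -> pairing a' k w = pairing a k w.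
  move=> w0; apply: eq_bigr => i _; rewrite /a'; case: ifP => // zi.
  by rewrite w0 // !mulr0.
have prod_u (c : I -> nat) : (forall i, z i == 0 -> c i = 0%N) ->
    \prod_i u i ^ (c i)%:Z * \prod_i z' i ^+ c i = \prod_i z i ^+ c i.
  move=> c0; rewrite -big_split; apply: eq_bigr => i _ /=.
  rewrite -exprnP -exprMn /u; case: ifP => [zi|/negbT zi].
    by rewrite c0 // !expr0.
  by rewrite mulfVK // -eq0.
have prod_z'_neq0 (c : I -> nat) : (forall i, z i == 0 -> c i = 0%N) ->
    \prod_i z' i ^+ c i != 0.
  move=> c0; apply/prodf_neq0 => i _; have [/c0->|zi] := boolP (z i == 0).
    by rewrite expr0 oner_neq0.
  by rewrite expf_neq0 // -eq0.
case: (pickP [pred i | (z i == 0) && (m i != 0%N)]) => [i /andP[zi mi]|none].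
  have mi' : (0 < m i)%N by rewrite lt0n.
  have zi' := zi; rewrite eq0 in zi'.
  rewrite (bigD1 i) // [RHS](bigD1 i) //= (eqP zi) (eqP zi') !expr0n.
  by rewrite (negPf mi) !mul0r.
have m0 i : z i == 0 -> m i = 0%N.
  by move=> zi; have := none i; rewrite /= zi => /negbFE/eqP.
rewrite -(prod_u m m0).
suff -> : \prod_i u i ^ (m i)%:Z = 1 by rewrite mul1r.
pose P (w : {ffun I -> int}) := \prod_i u i ^ w i = 1.
suff : P [ffun i => (m i)%:Z].
  by rewrite /P => e; rewrite -[RHS]e; apply: eq_bigr => i _; rewrite ffunE.
apply: (@short_generates I a' n _ _ P D) => //.
- split=> [|v w Pv Pw]; first by rewrite /P big1 // => i _; rewrite ffunE expr0z.
  rewrite /P (eq_bigr (fun i => u i ^ v i / u i ^ w i)) => [|i _].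
    by rewrite big_split /= prodfV Pv Pw divr1.
  by rewrite !ffunE expfzDr // invr_expz.
(* c forgets the entries of w on vanishing coordinates; this keeps it in the lattice and does not
   increase the weight. *)
- move=> w Kw w_ge0 le_w; pose c i := if z i == 0 then 0%N else `|w i|%N.
  have c0 i : z i == 0 -> c i = 0%N by rewrite /c => ->.
  rewrite /P (eq_bigr (fun i => u i ^ (c i)%:Z)) => [|i _]; last first.
    by rewrite /u /c; case: ifP => // _; [rewrite !exp1rz | rewrite gez0_abs].
  apply: (mulIf (prod_z'_neq0 c c0)); rewrite mul1r prod_u //; apply: eq_short.
    rewrite -lez_nat; apply: le_trans le_w; rewrite /weight -natz natr_sum.
    apply: ler_sum => i _; rewrite natz /c; case: ifP => _ //.
    by rewrite gez0_abs.
  move=> k; rewrite -pairingE => [|i /c0]; last by rewrite ffunE => ->.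
  suff <- : pairing a' k w = pairing a' k [ffun i => (c i)%:Z] by exact: Kw.
  apply: eq_bigr => i _; rewrite /a' ffunE /c; case: ifP => _; first by rewrite !mul0r.
  by rewrite gez0_abs.
- by move=> k; rewrite pairingE => [|i /m0]; [exact: Km | rewrite ffunE => ->].
Qed.
End UpperBound.

(** * The extremal module *)

Section DiagonalModule.
Variables (F : fieldType) (gT : finGroupType) (G : {group gT}) (n : nat).
Variable chi : gT -> 'I_n -> F.
Hypothesis chi1 : forall i, chi 1%g i = 1.
Hypothesis chiM :
  forall i, {in G &, {morph chi^~ i : g h / (g * h)%g >-> g * h}}.

Fact diagonal_mx_repr : mx_repr G (fun g => diag_mx (\row_i chi g i)).
Proof.
split=> [|g h Gg Gh].
  rewrite -diag_const_mx; congr diag_mx; apply/rowP => i.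
  by rewrite !mxE chi1.
by rewrite mulmx_diag; congr diag_mx; apply/rowP => i; rewrite !mxE chiM.
Qed.

Definition diagonal_module := MxRepresentation diagonal_mx_repr.
End DiagonalModule.

Section CharacterOf.
Variables (F : fieldType) (gT : finGroupType) (G : {group gT}) (r n : nat).
Variables (o : 'I_r -> nat) (x : 'I_r -> gT) (e : gT -> 'I_r -> nat).
Hypothesis eM : forall g h k, g \in G -> h \in G ->
  e (g * h)%g k = e g k + e h k %[mod o k].
Hypothesis ex : forall j k, e (x j) k = (j == k) %[mod o k].
Variables (zeta : 'I_r -> F) (a : 'I_r -> 'I_n -> int).
Hypothesis prim_zeta : forall k, (o k).-primitive_root (zeta k).

Definition dual_character g i : F := \prod_k (zeta k ^ a k i) ^+ e g k.

Let expr_eq k i c d : c = d %[mod o k] ->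
  (zeta k ^ a k i) ^+ c = (zeta k ^ a k i) ^+ d.
Proof.
have zo : (zeta k ^ a k i) ^+ o k = 1.
  rewrite exprnP exprz_exp mulrC -exprz_exp -exprnP (prim_expr_order (prim_zeta k)).
  exact: exp1rz.
by move=> cd; rewrite -(expr_mod c zo) -(expr_mod d zo) cd.
Qed.

Lemma dual_characterM i :
  {in G &, {morph dual_character^~ i : g h / (g * h)%g >-> g * h}}.
Proof.
move=> g h Gg Gh; rewrite /dual_character -big_split /=; apply: eq_bigr => k _.
by rewrite (expr_eq _ (eM k Gg Gh)) exprD.
Qed.

Lemma dual_character1 i : dual_character 1%g i = 1.
Proof.
rewrite /dual_character big1 // => k _.
have := eM k (group1 G) (group1 G); rewrite mulg1 -[X in X = _ %[mod _]]addn0.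
move/eqP; rewrite eqn_modDl => /eqP e1.
by rewrite -(expr_eq i e1) expr0.
Qed.

Lemma dual_character_gen k i : dual_character (x k) i = zeta k ^ a k i.
Proof.
rewrite /dual_character (bigD1 k) //= big1 ?mulr1 => [|l kl].
  by rewrite (expr_eq _ (ex k k)) eqxx expr1.
by rewrite (expr_eq _ (ex k l)) eq_sym (negPf kl) expr0.
Qed.
End CharacterOf.

(** * Both bounds for the given group *)

Section SeparatingNumber.
Variables (R : realType) (gT : finGroupType) (G : {group gT}).
Variables (H : 'I_4 -> {group gT}) (n : nat -> nat).
Hypothesis abG : abelian G.
Hypothesis defG : (\big[dprod/1]_k H k)%g = G.
Hypothesis cycH : forall k, cyclic (H k).
Hypothesis cardH : forall k : 'I_4, #|H k| = n k.
Hypothesis n_gt0 : forall k, (0 < n k)%N.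
Hypothesis n_dvd : forall k, (n k %| n k.+1)%N.
Hypothesis n0_gt1 : (1 < n 0)%N.
Local Notation C := R[i]%C.
Let D := (n 1 %/ pdiv (n 0) + n 2 + n 3)%N.

Lemma separated_upper d (rG : mx_representation C G d) : separated_in_degree rG D.
Proof.
have [x [e [Gx ox xe eM ex]]] := cyclic_coordinates abG defG cycH.
have [Q [chi [Q_unit diagQ]]] := abelian_diagonalization rG abG.
have chiM := diagonal_characterM Q_unit diagQ.
have chi1 i : chi 1%g i = 1.
  have := diagQ 1%g (group1 G); rewrite repr_mx1 mulmx1 -[LHS]mul1mx.
  move/(can_inj (mulmxK Q_unit))/matrixP/(_ i i).
  by rewrite !mxE eqxx.
have /boolp.choice[zeta prim_zeta] :
    forall k : 'I_4, exists z : C, (n k).-primitive_root z.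
  by move=> k; apply: prim_root_exists.
have chiX k i c : chi (x k ^+ c)%g i = chi (x k) i ^+ c.
  elim: c => [|c IH]; first by rewrite expg0 chi1.
  by rewrite expgS chiM ?groupX // IH exprS.
have /boolp.choice[a Ha] : forall k, exists b : 'I_d -> int, forall i,
    chi (x k) i = zeta k ^ b i.
  move=> k; suff /boolp.choice[b Hb] : forall i, exists c : int,
    chi (x k) i = zeta k ^ c by exists b.
  move=> i; have [|c ->] := prim_rootP (prim_zeta k) (x := chi (x k) i).
    by rewrite -chiX -cardH -ox expg_order chi1.
  by exists c.
have trivP := trivial_on_zero_sum Gx (fun g Gg => ex_intro _ _ (xe g Gg))
  prim_zeta chi1 chiM Ha.
apply: (separated_if_monomials Q_unit diagQ) => z z' eq_short m /trivP Km.
apply: (@short_monomials_separate C n D n_gt0 n_dvd n0_gt1 _ _ a) Km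
  => [q q_pr qn|c le_c Kc].
  (* The minimal prime divisor gives the largest quotient, so D serves all primes q dividing
     [n 0]. *)
  rewrite /D -!addnA leq_add2r; apply: leq_div2l; first exact: pdiv_gt0.
  by apply: pdiv_min_dvd => //; apply: prime_gt1.
by apply: eq_short => //; apply/trivP.
Qed.

Let p := pdiv (n 0).
Let b := (n 1 %/ p)%N.

Let p_pr : prime p. Proof. exact: pdiv_prime. Qed.
Let p_n0 : (p %| n 0)%N. Proof. exact: pdiv_dvd. Qed.
Let n1E : n 1 = (b * p)%N. Proof. by rewrite divnK // (dvdn_trans p_n0). Qed.

(* Five characters whose zero-sum vectors (m0, ..., m4) are given by the
   conditions m1 = m3 mod n1, b m3 + m4 = 0 mod n2, m2 + m3 = 0 mod n3 and
   m0 + m1 = 0 mod n4.  If p does not divide m1, it does not divide m3 either,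
   and this forces m4 >= b, m2 + m3 >= n3 and m0 + m1 >= n4. *)
Definition extremal_weights : seq (seq int) :=
  [:: [:: 0; 1; 0; -1; 0]; [:: 0; 0; 0; b%:Z; 1];
      [:: 0; 0; 1; 1; 0]; [:: 1; 1; 0; 0; 0]].

Definition extremal_characters (k : 'I_4) (i : 'I_5) : int :=
  nth 0 (nth [::] extremal_weights k) i.

Let big_ord5 (T : Type) (idx : T) (op : Monoid.law idx) (f : 'I_5 -> T) :
  \big[op/idx]_i f i = op (f (inord 0)) (op (f (inord 1)) (op (f (inord 2))
    (op (f (inord 3)) (f (inord 4))))).
Proof.
rewrite !big_ord_recl big_ord0 Monoid.mulm1.
by congr (op (f _) (op (f _) (op (f _) (op (f _) (f _))))); apply: val_inj;
  rewrite /= inordK.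
Qed.

Lemma extremal_zero_sumP (m : 'I_5 -> nat) :
  zero_sum extremal_characters (fun k : 'I_4 => n k) [ffun i => (m i)%:Z] <->
  [/\ ((n 0)%:Z %| (m (inord 1))%:Z - (m (inord 3))%:Z)%Z,
      (n 1 %| b * m (inord 3) + m (inord 4))%N,
      (n 2 %| m (inord 2) + m (inord 3))%N &
      (n 3 %| m (inord 0) + m (inord 1))%N].
Proof.
have wE k : pairing extremal_characters k [ffun i => (m i)%:Z] =
    nth 0 [:: (m (inord 1))%:Z - (m (inord 3))%:Z;
              (b * m (inord 3) + m (inord 4))%N%:Z;
              (m (inord 2) + m (inord 3))%N%:Z;
              (m (inord 0) + m (inord 1))%N%:Z] k.
  rewrite /pairing big_ord5 !ffunE /extremal_characters !inordK //.
  by case: k => [[|[|[|[|k]]]] //= _]; ring.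
split=> [zs|[z0 z1 z2 z3] [[|[|[|[|k]]]] // ltk]]; rewrite ?wE //.
by split; [have := zs (inord 0) | have := zs (inord 1) | have := zs (inord 2) |
  have := zs (inord 3)]; rewrite wE inordK.
Qed.

Lemma extremal_short (m : 'I_5 -> nat) :
    zero_sum extremal_characters (fun k : 'I_4 => n k) [ffun i => (m i)%:Z] ->
  (\sum_i m i < D)%N -> (p %| m (inord 1))%N.
Proof.
move/extremal_zero_sumP; rewrite big_ord5 /=.
set m0 := m (inord 0); set m1 := m (inord 1); set m2 := m (inord 2).
set m3 := m (inord 3); set m4 := m (inord 4).
move=> [z0 z1 z2 z3]; apply: contraTT => pm1.
have pm3 : ~~ (p %| m3)%N.
  apply: contra pm1 => pm3; rewrite -[(_ %| _)%N]/(p%:Z %| m1%:Z)%Z.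
  rewrite -[m1%:Z](subrK m3%:Z) rpredD //.
  by apply: dvdz_trans z0; rewrite dvdzE.
have ge3 : (n 3 <= m0 + m1)%N.
  apply: dvdn_leq => //; rewrite addn_gt0 orbC lt0n.
  by case: eqP pm1 => // ->; rewrite dvdn0.
have ge2 : (n 2 <= m2 + m3)%N.
  apply: dvdn_leq => //; rewrite addn_gt0 orbC lt0n.
  by case: eqP pm3 => // ->; rewrite dvdn0.
have b_gt0 : (0 < b)%N by have := n_gt0 1; rewrite n1E muln_gt0 => /andP[].
have bm4 : (b %| m4)%N.
  by rewrite -(dvdn_addr _ (dvdn_mulr m3 (dvdnn b))) (dvdn_trans _ z1) // n1E dvdn_mulr.
(* If m4 were 0, then n 1 = b p would divide b m3, and p would divide m3. *)
have ge1 : (b <= m4)%N.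
  apply: dvdn_leq => //; rewrite lt0n; apply: contra pm3 => /eqP m40.
  by move: z1; rewrite m40 addn0 n1E dvdn_pmul2l.
rewrite -leqNgt (_ : (_ + _)%N = (m4 + (m2 + m3) + (m0 + m1))%N).
  by rewrite !leq_add.
by ring.
Qed.

(** An invariant monomial whose exponent at index 1 is 1, hence not divisible by p. *)
Definition extremal_exponents (i : 'I_5) : nat :=
  nth 0%N [:: (n 3).-1; 1; (n 2).-1; 1; (n 1 - b)]%N i.

Lemma extremal_exponents_zero_sum :
  zero_sum extremal_characters (fun k : 'I_4 => n k)
    [ffun i => (extremal_exponents i)%:Z].
Proof.
apply/extremal_zero_sumP; rewrite /extremal_exponents !inordK //=; split.
- by rewrite subrr dvdz0.
- by rewrite muln1 subnKC // leq_div.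
- by rewrite addn1 prednK.
- by rewrite addn1 prednK.
Qed.

(** The points (1, w, 1, 1, 1) and (1, 1, 1, 1, 1), with w a primitive p-th root of unity, are
    separated by the extremal monomial. In an invariant of degree below D only powers w^m1 with p
    dividing m1 occur, so it takes equal values. *)
Lemma not_separated_below : exists rG : mx_representation C G 5,
  forall d, separated_in_degree rG d -> (D <= d)%N.
Proof.
have [x [e [Gx ox xe eM ex]]] := cyclic_coordinates abG defG cycH.
have /boolp.choice[zeta prim_zeta] :
    forall k : 'I_4, exists z : C, #|H k|.-primitive_root z.
  by move=> k; apply: prim_root_exists; rewrite cardH.
pose chi := dual_character e zeta extremal_characters.
have chi1 i : chi 1%g i = 1.
  exact: (dual_character1 eM extremal_characters prim_zeta).
have chiM i : {in G &, {morph chi^~ i : g h / (g * h)%g >-> g * h}}.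
  exact: (dual_characterM eM extremal_characters prim_zeta).
pose rG : mx_representation C G 5 := diagonal_module chi1 chiM.
have diag1 g : g \in G -> 1%:M *m rG g = diag_mx (\row_i chi g i) *m 1%:M.
  by rewrite mul1mx mulmx1.
have trivP m : trivial_on G chi m <->
    zero_sum extremal_characters (fun k : 'I_4 => n k) [ffun i => (m i)%:Z].
  apply: (trivial_on_zero_sum Gx _ _ chi1 chiM (zeta := zeta)) => [g Gg|k|k i].
  - by exists (e g); apply: xe.
  - by rewrite -cardH.
  - exact: (dual_character_gen ex).
exists rG => d [S [S_inv S_sep] S_hom]; rewrite leqNgt; apply/negP => lt_d.
have [w prim_w] := prim_root_exists C (prime_gt0 p_pr).
pose u (i : 'I_5) : C := if i == inord 1 then w else 1.
have prod_u (m : 'I_5 -> nat) : \prod_i u i ^+ m i = w ^+ m (inord 1).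
  rewrite (bigD1 (inord 1)) //= /u eqxx big1 ?mulr1 // => i /negPf->.
  by rewrite expr1n.
pose v1 : 'cV[C]_5 := \col_i u i; pose v2 : 'cV[C]_5 := \col_i 1.
have [|f Sf neq_f] := S_sep v1 v2.
  exists (invariant_monomial 1%:M extremal_exponents).
    apply: (invariant_monomialP diag1).
    exact/trivP/extremal_exponents_zero_sum.
  rewrite !peval_invariant_monomial !mul1mx.
  under eq_bigr => i _ do rewrite mxE; rewrite prod_u.
  under eq_bigr => i _ do rewrite mxE expr1n; rewrite big1 //.
  rewrite /extremal_exponents inordK //= expr1 => w1.
  have := prim_order_dvd prim_w 1; rewrite expr1 w1 eqxx dvdn1.
  by move/eqP => p1; have := prime_gt1 p_pr; rewrite p1.
have [k le_k hom_f] := S_hom f Sf.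
case: neq_f; rewrite /peval.
apply: (invariant_eval_eq chiM) => [g v Gg|m m_supp triv].
  have := S_inv f Sf g^-1%g; rewrite groupV => /(_ Gg) inv_f.
  have := peval_pact rG g^-1%g f (\col_i v i); rewrite inv_f /mact invgK /peval.
  under [X in X = _]meval_eq => i do rewrite mxE.
  move=> ->; apply: meval_eq => i.
  transitivity ((diag_mx (\row_j chi g j) *m \col_j v j) i 0); last by [].
  by rewrite mul_diag_mx !mxE.
rewrite (eq_bigr (fun i => u i ^+ m i)) => [|i _]; last by rewrite mxE.
rewrite prod_u big1 => [|i _]; last by rewrite mxE expr1n.
apply/eqP; rewrite -(prim_order_dvd prim_w); apply: extremal_short.
  exact/trivP.
apply: leq_ltn_trans lt_d; rewrite -mdegE.
by have -> : mdeg m = k := dhomog_mf hom_f m_supp.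
Qed.

End SeparatingNumber.

(** * The value of the separating Noether number *)

Lemma dprod_abelian (gT : finGroupType) (A B L : {group gT}) :
  (A \x B)%g = L -> abelian A -> abelian B -> abelian L.
Proof. by case/dprodP=> _ <- cAB _ abA abB; rewrite abelianM abA abB cAB. Qed.

Theorem theorem1p4 (R : realType) (gT : finGroupType) (G : {group gT})
    (H1 H2 H3 H4 : {group gT}) (n1 n2 n3 n4 : nat)
    (defG : (H1 \x H2 \x H3 \x H4)%g = G)
    (cycH1 : cyclic H1) (cycH2 : cyclic H2)
    (cycH3 : cyclic H3) (cycH4 : cyclic H4)
    (cardH1 : #|H1| = n1) (cardH2 : #|H2| = n2)
    (cardH3 : #|H3| = n3) (cardH4 : #|H4| = n4)
    (n1_gt1 : (1 < n1)%N)
    (n1_dvd_n2 : (n1 %| n2)%N) (n2_dvd_n3 : (n2 %| n3)%N)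
    (n3_dvd_n4 : (n3 %| n4)%N) :
  beta_sep R G = ((n2 %/ pdiv n1 + n3 + n4)%N%:R)%:E.
Proof.
pose H (k : 'I_4) : {group gT} := nth H4 [:: H1; H2; H3] k.
(* The default [n4] is the value at index 3 and keeps the sequence constant afterwards, so the
   divisibility chain holds at every index. *)
pose n k := nth n4 [:: n1; n2; n3] k.
have cardH k : #|H k| = n k by case: k => [[|[|[|[|k]]]]].
have cycH k : cyclic (H k) by case: k => [[|[|[|[|k]]]]].
have bigG : (\big[dprod/1]_k H k)%g = G.
  by rewrite !big_ord_recr big_ord0 /= dprod1g.
have abG : abelian G.
  case/dprodP: (defG) => [[K3 _ defK3 _] _ _ _].
  case/dprodP: (defK3) => [[K2 _ defK2 _] _ _ _].
  rewrite defK3 in defG; rewrite defK2 in defK3.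
  apply: (dprod_abelian defG); last exact: cyclic_abelian.
  apply: (dprod_abelian defK3); last exact: cyclic_abelian.
  by apply: (dprod_abelian defK2); exact: cyclic_abelian.
have n_gt0 k : (0 < n k)%N.
  rewrite /n; case: k => [|[|[|k]]] /=;
    by rewrite -?cardH1 -?cardH2 -?cardH3 ?nth_nil -?cardH4.
have n_dvd k : (n k %| n k.+1)%N by case: k => [|[|[|k]]]; rewrite /n /= ?nth_nil.
have [rG0 lower] := not_separated_below R abG bigG cycH cardH n_gt0 n_dvd n1_gt1.
have upper := separated_upper abG bigG cycH cardH n_gt0 n_dvd n1_gt1.
pose D := (n 1 %/ pdiv (n 0) + n 2 + n 3)%N.
have D_gt0 : (0 < D)%N by rewrite addn_gt0 n_gt0 orbT.
apply/eqP; rewrite eq_le; apply/andP; split.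
  apply/ereal.ge_ereal_sup => _ [d [rG ->]]; apply: ereal.ge_ereal_inf.
  by exists D%:R%:E => //; exists D.
apply: ereal.le_ereal_sup_tmp; exists (beta_sep_module rG0); first by exists 5%N, rG0.
apply/ereal.le_ereal_inf_tmp => _ [d [_ /lower le_d] <-].
by rewrite lee_fin ler_nat.
Qed.
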